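(* Let $0\le s<p<q<r\le\infty$. Then $$Int(\ell^{p},\ell^{q})=Int(\ell^{s},\ell^{q})\cap Int(\ell^{p},\ell^{r}).$$
   Context: All sequences are real, with coordinate-wise operations. For $0<p<\infty$, $\ell^p$ is the space of sequences with $\|x\|_{\ell^p}=(\sum_k|x_k|^p)^{1/p}<\infty$; $\ell^\infty$ is the space of bounded sequences with the sup norm; $\ell^0$ is the linear space of eventually zero sequences equipped with $\|x\|_{\ell^0}:=\mathrm{card}\{k:x_k\ne0\}$ (a group quasi-norm, sub-additive but not homogeneous, generating the discrete topology). For $0\le p<q\le\infty$ one has $\ell^p\subset\ell^q$. A map $T$ is bounded on $X$ if $\|T\|_{X\to X}:=\sup_{x\ne0}\|Tx\|_X/\|x\|_X<\infty$. For $0\le p<q\le\infty$, $\mathfrak{L}(\ell^p,\ell^q)$ is the set of all bounded linear operators $T:\ell^q\to\ell^q$ whose restriction to $\ell^p$ is a bounded map of $\ell^p$ into itself. $Int(\ell^p,\ell^q)$ is the class of all quasi-Banach spaces $E$ with continuous inclusions $\ell^p\subset E\subset\ell^q$ such that every $T\in\mathfrak{L}(\ell^p,\ell^q)$ maps $E$ boundedly into $E$. *)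

(* Defs.v *)
From HB Require Import structures.
From mathcomp Require Import all_boot all_order all_algebra.
From mathcomp Require Import all_classical all_reals all_analysis.

Set Implicit Arguments.
Unset Strict Implicit.
Unset Printing Implicit Defensive.

Import Order.TTheory GRing.Theory Num.Theory numFieldNormedType.Exports.

Local Open Scope classical_set_scope.
Local Open Scope ring_scope.

(* A set of real sequences together with a size functional, whose values
   outside the carrier are irrelevant. The record carries no axioms so that it
   covers both l^0, whose functional is not homogeneous, and quasi-Banach
   spaces (see is_quasi_banach). *)
Record seq_space (R : realType) := SeqSpace {
  carrier : set (R^nat) ;
  qnorm : R^nat -> R }.

(* At p = 0 the library's Lnorm is not the cardinality of the support, hence
   the separate case. *)
Definition lpnorm (R : realType) (p : \bar R) (x : R^nat) : \bar R :=
  if p == 0%E then counting [set k | x k != 0]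
  else Lnorm counting p (EFin \o x).

Definition lp (R : realType) (p : \bar R) : seq_space R :=
  SeqSpace [set x | (lpnorm p x < +oo)%E] (fun x => fine (lpnorm p x)).

Definition opnorm (R : realType) (X : seq_space R) (T : R^nat -> R^nat)
    : \bar R :=
  ereal_sup [set (qnorm X (T x) / qnorm X x)%:E |
             x in carrier X `&` [set x | x != 0]].

Definition bounded_map (R : realType) (X : seq_space R) (T : R^nat -> R^nat)
    : Prop :=
  (forall x, carrier X x -> carrier X (T x)) /\ (opnorm X T < +oo)%E.

Definition linear_map_on (R : realType) (X : seq_space R)
    (T : R^nat -> R^nat) : Prop :=
  forall (a : R) (x y : R^nat), carrier X x -> carrier X y ->
    T (a *: x + y) = a *: T x + T y.

(* The operators are total functions on sequences, but only their values on
   l^q are constrained or used. *)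
Definition bounded_operators (R : realType) (p q : \bar R)
    : set (R^nat -> R^nat) :=
  [set T | [/\ linear_map_on (lp q) T, bounded_map (lp q) T
             & bounded_map (lp p) T]].

(* Continuity is stated for the topologies generated by the functionals rather
   than as a bound qnorm Y x <= C * qnorm X x: for X = l^0, which is discrete,
   no such bound holds when qnorm Y is homogeneous and nonzero on X. *)
Definition continuous_inclusion (R : realType) (X Y : seq_space R) : Prop :=
  carrier X `<=` carrier Y /\
  forall a, carrier X a -> forall e : R, 0 < e -> exists2 d : R, 0 < d &
    forall x, carrier X x -> qnorm X (x - a) < d -> qnorm Y (x - a) < e.

Definition is_quasi_norm (R : realType) (E : seq_space R) : Prop :=
  [/\ forall x, carrier E x -> 0 <= qnorm E x,
      forall x, carrier E x -> (qnorm E x = 0 <-> x = 0),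
      forall (a : R) x, carrier E x -> qnorm E (a *: x) = `|a| * qnorm E x
    & exists K : R, forall x y, carrier E x -> carrier E y ->
        qnorm E (x + y) <= K * (qnorm E x + qnorm E y)].

Definition is_complete (R : realType) (E : seq_space R) : Prop :=
  forall u : nat -> R^nat, (forall n, carrier E (u n)) ->
    (forall e : R, 0 < e -> exists N : nat, forall m n : nat,
       (N <= m)%N -> (N <= n)%N -> qnorm E (u m - u n) < e) ->
    exists2 x, carrier E x & qnorm E (u n - x) @[n --> \oo] --> 0.

Definition is_quasi_banach (R : realType) (E : seq_space R) : Prop :=
  [/\ submod_closed (mem (carrier E)), is_quasi_norm E & is_complete E].

Definition Int (R : realType) (p q : \bar R) : set (seq_space R) :=
  [set E | [/\ is_quasi_banach E,
               continuous_inclusion (lp p) E,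
               continuous_inclusion E (lp q)
             & forall T, bounded_operators p q T -> bounded_map E T]].

(* Main.v *)
Require Import Defs.
From mathcomp Require Import all_boot all_order all_algebra.
From mathcomp Require Import all_classical all_reals all_analysis.
From mathcomp Require Import ring lra finmap ess_sup_inf.

(** The inclusion from left to right says that l^p interpolates between l^s and
    l^q, and l^q between l^p and l^r: then every operator of the couples (l^s, l^q)
    and (l^p, l^r) belongs to the couple (l^p, l^q). This is Marcinkiewicz's
    theorem [interpolation], valid down to s = 0 because the counting of supports
    is itself a weak type estimate.

    For the converse let E be in both classes, x in E and T bounded on l^p and on
    l^q. By the closed graph theorem [closed_graph] it is enough to show that T x
    belongs to E, that is, to obtain T x from x by finitely many operators of the
    couples (l^s, l^q) and (l^p, l^r), which may depend on x. Put Q = max(q, 1);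
    on l^q the operator T is also bounded for the norm of l^Q ([bounded_lp_max1]).
    The exponent Q >= 1 is what allows means over blocks to be bounded operators.

    Let x* and y* be the decreasing rearrangements of |x| and of |T x| + |x|.
    Cutting x after its n largest entries shows that for each n one of two things
    happens ([head_tail_alternative]): either the sum of the p-th powers of the
    first n entries of y* is controlled by that of x*, or the sum of the Q-th
    powers of the remaining entries of y* is controlled by that of x*.

    In the first case the entries of y* can be put into bins of sizes x*_i which
    are at least as large as they are and not overfull in the sense of p-th powers
    ([fill_bins]). The map z |-> (y*_k / x*_phi(k) z_phi(k))_k, where phi(k) is the
    bin of k, takes x* to y* at these indices; it is bounded on l^p and on l^oo,
    and likewise on l^r.

    In the second case, consecutive disjoint blocks of indices carry enough Q-th
    power mass of x* to reproduce y*_k from the block of k, unless y*_k is at most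
    a multiple of x*_k ([tail_blocks]). A suitable mean over each block defines an
    operator bounded on l^0, since blocks are disjoint, and on l^q; by
    interpolation it belongs to the couple (l^s, l^q). Restricting each operator
    to the indices where it is needed, y* is a sum of three images of x*
    ([sorted_transfer]). *)

Set Implicit Arguments.
Unset Strict Implicit.
Unset Printing Implicit Defensive.

Import Order.TTheory GRing.Theory Num.Theory numFieldNormedType.Exports.

Local Open Scope classical_set_scope.
Local Open Scope ring_scope.

(** * Modulars of sequences *)

(** At p = 0 the indicator replaces the power, because 0 `^ 0 = 1. *)
Definition lpterm (R : realType) (p v : R) : R :=
  if p == 0 then (v != 0)%:R else `|v| `^ p.

Definition lpsum_le (R : realType) (p : R) (z : R^nat) (B : R) : Prop :=
  forall N, \sum_(k < N) lpterm p (z k) <= B.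

Section LpTerm.
Variable R : realType.
Implicit Types (p v B : R) (z : R^nat).

Lemma lpterm_ge0 p v : 0 <= lpterm p v.
Proof. by rewrite /lpterm; case: ifP => _; rewrite ?ler0n ?powR_ge0. Qed.

Lemma lpterm0 p : lpterm p 0 = 0.
Proof.
rewrite /lpterm eqxx normr0; case: eqVneq => [//|p0]; exact: powR0.
Qed.

Lemma lpterm_neq0 p v : v != 0 -> lpterm p v = `|v| `^ p.
Proof.
by move=> v0; rewrite /lpterm v0; case: eqVneq => // ->; rewrite powRr0.
Qed.

Lemma lpterm_pos p v : p != 0 -> lpterm p v = `|v| `^ p.
Proof. by rewrite /lpterm => /negbTE ->. Qed.

Lemma lpterm_gt0 p v : v != 0 -> 0 < lpterm p v.
Proof. by move=> v0; rewrite lpterm_neq0// powR_gt0// normr_gt0. Qed.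

Lemma lpterm_eq0 p v : lpterm p v = 0 -> v = 0.
Proof. by move=> h; apply/eqP; apply/negPn/negP => /(lpterm_gt0 p); rewrite h ltxx. Qed.

Lemma ge0_sum_ord_le (u : nat -> R) (M N : nat) : (forall k, 0 <= u k) ->
  (M <= N)%N -> \sum_(k < M) u k <= \sum_(k < N) u k.
Proof.
move=> u0 MN; rewrite -!(big_mkord xpredT u) (big_cat_nat _ MN)//= lerDl.
by apply: sumr_ge0.
Qed.

Lemma lpsum_le_term p z B k : lpsum_le p z B -> lpterm p (z k) <= B.
Proof.
move=> /(_ k.+1); apply: le_trans; rewrite big_ord_recr /= lerDr.
by apply: sumr_ge0 => i _; exact: lpterm_ge0.
Qed.

Lemma lpsum_le_ge0 p z B : lpsum_le p z B -> 0 <= B.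
Proof. by move=> /(lpsum_le_term 0); apply: le_trans; exact: lpterm_ge0. Qed.

Lemma nneseries_leP (u : nat -> R) B : (forall k, 0 <= u k) ->
  ((\sum_(k <oo) (u k)%:E <= B%:E)%E <-> forall N, \sum_(k < N) u k <= B).
Proof.
move=> u0; split => [h N|h].
  rewrite -lee_fin (le_trans _ h)// -sumEFin -(big_mkord xpredT (EFin \o u)).
  by apply: nneseries_lim_ge => k _ _; rewrite lee_fin.
apply: lime_le; first by apply: is_cvg_nneseries => k _ _; rewrite lee_fin.
by near=> N; rewrite big_mkord sumEFin lee_fin.
Unshelve. all: by end_near. Qed.

(** The modular: the p-th power of the l^p size, or the size itself for p = 0,
    where powers degenerate. *)
Definition lpmod p z : \bar R := (\sum_(k <oo) (lpterm p (z k))%:E)%E.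

Lemma lpmod_ge0 p z : (0 <= lpmod p z)%E.
Proof. by apply: nneseries_ge0 => k _ _; rewrite lee_fin lpterm_ge0. Qed.

Lemma lpmod_leP p z B : (lpmod p z <= B%:E)%E <-> lpsum_le p z B.
Proof. by apply: nneseries_leP => k; exact: lpterm_ge0. Qed.

Lemma lpmod_finP p z : (lpmod p z < +oo)%E <-> exists B, lpsum_le p z B.
Proof.
split => [h|[B /lpmod_leP h]]; last by rewrite (le_lt_trans h)// ltry.
exists (fine (lpmod p z)); apply/lpmod_leP.
by rewrite fineK// ge0_fin_numE// lpmod_ge0.
Qed.

Lemma lpnorm0E z : lpnorm 0%:E z = lpmod 0 z.
Proof.
rewrite /lpnorm eqxx counting_dirac; apply: eq_eseriesr => k _.
rewrite diracE /lpterm eqxx; congr (_%:R%:E); rewrite -[RHS]/(nat_of_bool _).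
by congr nat_of_bool; apply/idP/idP => [/set_mem//|h]; exact: mem_set.
Qed.

Lemma lpnorm_posE p z : 0 < p -> lpnorm p%:E z = (lpmod p z `^ p^-1)%E.
Proof.
move=> p0; rewrite /lpnorm eqe gt_eqF// Lnorm_counting//; congr (_ `^ _)%E.
by apply: eq_eseriesr => k _; rewrite /= lpterm_pos// gt_eqF.
Qed.

Lemma lpnorm_ge0 (p : \bar R) z : (0 <= lpnorm p z)%E.
Proof.
by rewrite /lpnorm; case: ifP => _; [exact: measure_ge0|exact: Lnorm_ge0].
Qed.

Lemma carrier_lp_finP p z : 0 <= p ->
  (carrier (lp p%:E) z <-> exists B, lpsum_le p z B).
Proof.
rewrite le_eqVlt => /orP[/eqP<-|p0].
  by rewrite /= lpnorm0E; exact: lpmod_finP.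
rewrite /= lpnorm_posE// -lpmod_finP; split; last exact: poweR_lty.
by apply: lty_poweRy; rewrite invr_neq0// gt_eqF.
Qed.

(** The size belonging to the modular B. *)
Definition fin_lproot p (B : R) : R := if p == 0 then B else B `^ p^-1.

Lemma qnorm_lp_fin_le p z B : 0 <= p ->
  lpsum_le p z B -> qnorm (lp p%:E) z <= fin_lproot p B.
Proof.
rewrite le_eqVlt /fin_lproot => /orP[/eqP<-|p0] h; have := h => /lpmod_leP.
  rewrite eqxx /= lpnorm0E => hm; rewrite -lee_fin fineK//.
  by rewrite ge0_fin_numE ?lpmod_ge0// (le_lt_trans hm)// ltry.
rewrite gt_eqF// /= lpnorm_posE// => hm; rewrite -lee_fin fineK.
  rewrite -poweR_EFin; apply: gt0_ler_poweR => //; first by rewrite invr_ge0 ltW.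
  - by rewrite in_itv/= lpmod_ge0 leey.
  - by rewrite in_itv/= leey lee_fin (lpsum_le_ge0 h).
rewrite ge0_fin_numE ?poweR_ge0//.
by apply: poweR_lty; rewrite (le_lt_trans hm)// ltry.
Qed.

Lemma lpsum_le_qnorm p z : 0 <= p -> carrier (lp p%:E) z ->
  exists2 B, lpsum_le p z B & fin_lproot p B = qnorm (lp p%:E) z.
Proof.
move=> p0 /(carrier_lp_finP z p0) /lpmod_finP h.
exists (fine (lpmod p z)).
  by apply/lpmod_leP; rewrite fineK// ge0_fin_numE// lpmod_ge0.
move: p0; rewrite /fin_lproot le_eqVlt => /orP[/eqP p0|p0].
  by rewrite -p0 eqxx /= lpnorm0E.
rewrite gt_eqF//= lpnorm_posE// -[in RHS](@fineK _ (lpmod p z)) ?poweR_EFin//.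
by rewrite ge0_fin_numE// lpmod_ge0.
Qed.

End LpTerm.

(** * Balls of the sequence spaces, and bounded operators *)

(** For finite p the radius B bounds the modular, which is additive over
    entries, rather than its root. *)
Definition lpball (R : realType) (p : \bar R) (z : R^nat) (B : R) : Prop :=
  if p is r%:E then lpsum_le r z B else forall k, `|z k| <= B.

(** The size belonging to the radius B of a ball. *)
Definition lproot (R : realType) (p : \bar R) (B : R) : R :=
  if p is r%:E then fin_lproot r B else B.

Section LpBall.
Variable R : realType.
Implicit Types (p : \bar R) (r v B C : R) (z : R^nat).

Lemma counting_eq0 (A : set nat) : @counting nat R A = 0%E -> A = set0.
Proof.
rewrite /counting; case: ifPn => // /asboolP fA [] /eqP.
rewrite pnatr_eq0 => /eqP/cardfs0_eq h.
by rewrite -(fset_setK fA) h; apply/seteqP; split => x //=; rewrite inE.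
Qed.

Lemma lpnorm_oo_leP z B :
  ((lpnorm +oo z <= B%:E)%E <-> forall k, `|z k| <= B).
Proof.
rewrite /lpnorm /= unlock; case: ifPn => [_|]; last first.
  by rewrite -leNgt measure_le0 => /eqP /counting_eq0/seteqP[/(_ 0%N I)].
split => [/ess_supP[A [mA A0 hA]] k|h].
  move: A0 => /counting_eq0 A0; rewrite A0 in hA.
  by apply: contrapT => hk; apply: (hA k) => /=; rewrite lee_fin.
by apply/ess_supP; apply: aeW => k /=; rewrite lee_fin.
Qed.

Lemma lpball_ge0 p z B : lpball p z B -> 0 <= B.
Proof.
case: p => [r|/(_ 0%N)|/(_ 0%N)] /=; first exact: lpsum_le_ge0.
all: by apply: le_trans.
Qed.

Lemma lproot_ge0 p B : 0 <= B -> 0 <= lproot p B.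
Proof.
by case: p => [r||]//=; rewrite /fin_lproot; case: ifP => // _; rewrite powR_ge0.
Qed.

Lemma lprootM p B C : (0 <= p)%E -> 0 <= B -> 0 <= C ->
  lproot p (B * C) = lproot p B * lproot p C.
Proof.
by case: p => [r||]//= r0 B0 C0; rewrite /fin_lproot; case: ifP => // _; rewrite powRM.
Qed.

Lemma lproot_lt p B C : (0 <= p)%E -> 0 <= B -> B < C -> lproot p B < lproot p C.
Proof.
case: p => [r||]//=; rewrite lee_fin /fin_lproot => r0 B0 BC.
case: eqVneq => // r1; apply: gt0_ltr_powR => //.
- by rewrite invr_gt0 lt_neqAle eq_sym r1.
- by rewrite nnegrE (le_trans B0)// ltW.
Qed.

Lemma lproot_le p B C : (0 <= p)%E -> 0 <= B -> 0 <= C ->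
  (lproot p B <= lproot p C) = (B <= C).
Proof.
move=> p0 B0 C0; apply/idP/idP => [|h].
  by apply: contraTT; rewrite -!ltNge; exact: lproot_lt.
by move: h; rewrite le_eqVlt => /orP[/eqP->//|/(lproot_lt p0 B0)/ltW].
Qed.

(** Every operator norm thus has a counterpart for modulars. *)
Lemma lproot_surj p C : (0 <= p)%E -> 0 <= C ->
  exists2 B, 0 <= B & lproot p B = C.
Proof.
case: p => [r||]//= r0 C0; rewrite /fin_lproot; last by exists C.
case: eqVneq => r1; first by exists C.
by exists (C `^ r); rewrite ?powR_ge0// -powRrM mulfV// powRr1.
Qed.

Lemma carrier_lpP p z : (0 <= p)%E -> (carrier (lp p) z <-> exists B, lpball p z B).
Proof.
case: p => [r||]// p0 /=; first by rewrite -carrier_lp_finP.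
split => [h|[B /lpnorm_oo_leP h]]; last by rewrite (le_lt_trans h)// ltry.
exists (fine (lpnorm +oo z)); apply/lpnorm_oo_leP.
by rewrite fineK// ge0_fin_numE// lpnorm_ge0.
Qed.

Lemma qnorm_lp_le p z B : (0 <= p)%E -> lpball p z B ->
  qnorm (lp p) z <= lproot p B.
Proof.
case: p => [r||]// p0 /=; first by move=> h; exact: qnorm_lp_fin_le.
move=> /lpnorm_oo_leP h; rewrite -lee_fin fineK//.
by rewrite ge0_fin_numE ?lpnorm_ge0// (le_lt_trans h)// ltry.
Qed.

Lemma lpball_qnorm p z : (0 <= p)%E -> carrier (lp p) z ->
  exists2 B, lpball p z B & lproot p B = qnorm (lp p) z.
Proof.
case: p => [r||]// p0 /= h; first exact: lpsum_le_qnorm.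
exists (fine (lpnorm +oo z)) => //; apply/lpnorm_oo_leP.
by rewrite fineK// ge0_fin_numE// lpnorm_ge0.
Qed.

Lemma lpball0 p B : 0 <= B -> lpball p 0 B.
Proof.
case: p => [r||]/= B0 k; last 2 first.
- by rewrite normr0.
- by rewrite normr0.
by rewrite big1// => i _; exact: lpterm0.
Qed.

Lemma lpball_le p z B C : B <= C -> lpball p z B -> lpball p z C.
Proof. by case: p => [r||]/= BC h k; exact: le_trans (h k) BC. Qed.

Lemma lpball_eq0 p z : lpball p z 0 -> z = 0.
Proof.
case: p => [r||]/= h; apply/funext => k.
- apply: (@lpterm_eq0 _ r); apply/eqP; rewrite eq_le lpterm_ge0 andbT.
  exact: lpsum_le_term h.
- by apply/eqP; rewrite -normr_le0.
- by apply/eqP; rewrite -normr_le0.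
Qed.

Lemma qnorm_lp_ge0 p z : 0 <= qnorm (lp p) z.
Proof. by rewrite /= fine_ge0// lpnorm_ge0. Qed.

Lemma qnorm_lp_eq0 p z : (0 <= p)%E -> carrier (lp p) z ->
  qnorm (lp p) z = 0 -> z = 0.
Proof.
move=> p0 /(lpball_qnorm p0)[B zB <-] h; apply: (@lpball_eq0 p).
apply: lpball_le zB; rewrite leNgt; apply/negP => B0.
have := lproot_lt p0 (lexx 0) B0; rewrite h ltNge.
by rewrite lproot_ge0.
Qed.

Lemma qnorm_lp0 p : (0 <= p)%E -> qnorm (lp p) 0 = 0.
Proof.
move=> p0; apply/eqP; rewrite eq_le qnorm_lp_ge0 andbT.
have := qnorm_lp_le p0 (lpball0 p (lexx 0)); congr (_ <= _).
case: p p0 => //= r _; rewrite /fin_lproot; case: eqVneq => // r0.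
by rewrite powR0// invr_neq0.
Qed.

Lemma carrier_lp0 p : (0 <= p)%E -> carrier (lp p) 0.
Proof. by move=> p0; apply/(carrier_lpP _ p0); exists 0; exact: lpball0. Qed.

(** The larger of |u| and |v| dominates half of |u + v|: this is the
    quasi-triangle inequality, for all exponents at once. *)
Lemma lptermD r u v : 0 <= r ->
  lpterm r (u + v) <= 2 `^ r * (lpterm r u + lpterm r v).
Proof.
move=> r0.
wlog uv : u v / `|u| <= `|v|.
  move=> H; have [uv|/ltW vu] := leP `|u| `|v|; first exact: H.
  by rewrite addrC (addrC (lpterm _ _)); exact: H.
have [->|v0] := eqVneq v 0.
  rewrite addr0 lpterm0 addr0 ler_peMl ?lpterm_ge0//.
  by have := @ler_powR R 2 _ 0 r r0; rewrite powRr0; apply; rewrite ler1n.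
have [uv0|uv0] := eqVneq (u + v) 0.
  rewrite uv0 lpterm0 mulr_ge0 ?powR_ge0// addr_ge0 ?lpterm_ge0//.
rewrite lpterm_neq0// (@le_trans _ _ (2 `^ r * lpterm r v))//; last first.
  by rewrite ler_wpM2l ?powR_ge0// lerDr lpterm_ge0.
rewrite lpterm_neq0// -powRM//; apply: ge0_ler_powR => //; rewrite ?nnegrE//.
by rewrite (le_trans (ler_normD _ _))// mulr_natl mulr2n lerD.
Qed.

Lemma lptermM r u v : 0 <= r -> lpterm r (u * v) <= `|u| `^ r * lpterm r v.
Proof.
move=> r0; have [->|uv0] := eqVneq (u * v) 0.
  by rewrite lpterm0 mulr_ge0 ?powR_ge0// lpterm_ge0.
have v0 : v != 0 by apply: contraNneq uv0 => ->; rewrite mulr0.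
by rewrite !lpterm_neq0// normrM powRM.
Qed.

Lemma lpsum_leD r x y B C : 0 <= r -> lpsum_le r x B -> lpsum_le r y C ->
  lpsum_le r (x + y) (2 `^ r * (B + C)).
Proof.
move=> r0 xB yC N.
apply: (@le_trans _ _ (\sum_(k < N) 2 `^ r * (lpterm r (x k) + lpterm r (y k)))).
  by apply: ler_sum => k _; exact: lptermD.
by rewrite -mulr_sumr ler_wpM2l ?powR_ge0// big_split lerD.
Qed.

Lemma carrier_lpD p (a : R) x y : (0 <= p)%E ->
  carrier (lp p) x -> carrier (lp p) y -> carrier (lp p) (a *: x + y).
Proof.
move=> p0 /(carrier_lpP _ p0)[B xB] /(carrier_lpP _ p0)[C yC].
apply/(carrier_lpP _ p0); case: p p0 xB yC => [r||]//= r0 xB yC; last first.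
  exists (`|a| * B + C) => k; rewrite (le_trans (ler_normD _ _))// lerD//.
  by rewrite normrM ler_wpM2l.
exists (2 `^ r * (`|a| `^ r * B + C)); apply: lpsum_leD => // N.
apply: (@le_trans _ _ (\sum_(k < N) `|a| `^ r * lpterm r (x k))).
  by apply: ler_sum => k _; exact: lptermM.
by rewrite -mulr_sumr ler_wpM2l ?powR_ge0.
Qed.

Lemma carrier_lpB p x y : (0 <= p)%E ->
  carrier (lp p) x -> carrier (lp p) y -> carrier (lp p) (x - y).
Proof.
move=> p0 hx hy; rewrite addrC -scaleN1r; exact: carrier_lpD.
Qed.

Lemma bounded_mapP (X : seq_space R) (T : R^nat -> R^nat) :
  (forall x, carrier X x -> x != 0 -> 0 < qnorm X x) -> qnorm X 0 = 0 ->
  T 0 = 0 ->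
  bounded_map X T <-> (exists2 C : R, 0 <= C & forall x, carrier X x ->
    carrier X (T x) /\ qnorm X (T x) <= C * qnorm X x).
Proof.
move=> Xpos X0 T0; split => [[XT h]|[C C0 h]].
  have : exists B : R, (opnorm X T <= B%:E)%E.
    case: (opnorm X T) h => [B||]// _; first by exists B.
    by exists 0; rewrite leNye.
  move=> [B hB]; exists (Num.max B 0); first by rewrite le_max lexx orbT.
  move=> x Xx; split; first exact: XT.
  have [->|x0] := eqVneq x 0; first by rewrite T0 X0 mulr0.
  rewrite -ler_pdivrMr ?Xpos// le_max; apply/orP; left.
  rewrite -lee_fin (le_trans _ hB)//; apply: ereal_sup_ubound.
  by exists x => //; split => //=; apply/eqP.
split => [x /h[]//|].
apply: (@le_lt_trans _ _ C%:E); last exact: ltry.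
apply: ge_ereal_sup => _ [x [Xx /= x0] <-]; rewrite lee_fin ler_pdivrMr ?Xpos//.
by case: (h x Xx).
Qed.

(** Boundedness read on modulars takes the same form for l^0, for l^p and for
    l^oo, although the functionals have different degrees of homogeneity. *)
Lemma bounded_lpP p (T : R^nat -> R^nat) : (0 <= p)%E -> T 0 = 0 ->
  bounded_map (lp p) T <-> (exists2 C : R, 0 <= C &
    forall z B, lpball p z B -> lpball p (T z) (C * B)).
Proof.
move=> p0 T0; rewrite bounded_mapP//; last 2 first.
- move=> x hx x0; rewrite lt_neqAle qnorm_lp_ge0 andbT eq_sym.
  by apply: contra_neq x0; exact: qnorm_lp_eq0.
- exact: qnorm_lp0.
split => [[C C0 h]|[C C0 h]].
  have [D D0 DC] := lproot_surj p0 C0; exists D => // z B zB.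
  have [] := h z; first by apply/(carrier_lpP _ p0); exists B.
  move=> /(lpball_qnorm p0)[B' TzB' <-] h'; have B'0 := lpball_ge0 TzB'; apply: lpball_le TzB'.
  rewrite -(lproot_le p0) ?mulr_ge0 ?(lpball_ge0 zB)//.
  rewrite (le_trans h')// lprootM ?(lpball_ge0 zB)// DC ler_wpM2l//.
  exact: qnorm_lp_le.
exists (lproot p C); first exact: lproot_ge0.
move=> x /(lpball_qnorm p0)[B xB <-]; have h' := h _ _ xB; split.
  by apply/(carrier_lpP _ p0); exists (C * B).
by rewrite -lprootM ?(lpball_ge0 xB)//; exact: qnorm_lp_le.
Qed.

End LpBall.

(** * Dyadic sums *)

Section Layer.
Variable R : realType.
Implicit Types (p s r t a : R).

Lemma le_powR r (x y : R) : 0 <= r -> 0 <= x -> x <= y -> x `^ r <= y `^ r.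
Proof.
by move=> r0 x0 xy; apply: ge0_ler_powR => //; rewrite nnegrE// (le_trans x0).
Qed.

Lemma powRVM (x y : R) r : 0 <= x -> 0 <= y -> (x / y) `^ r = x `^ r * y `^ (- r).
Proof.
by move=> x0 y0; rewrite powRM ?invr_ge0// -powR_inv1// -powRrM mulN1r.
Qed.

Lemma powR2_gt1 r : 0 < r -> 1 < (2 : R) `^ r.
Proof.
move=> r0; have := @gt0_ltr_powR R r r0 1 2; rewrite powR1; apply.
- by rewrite nnegrE.
- by rewrite nnegrE.
- by rewrite ltr1n.
Qed.

(** Comparing with an increment of the sequence of capped powers makes the sum
    of the dyadic powers below a given level telescope. *)
Lemma dyadic_sum_below (al t a : R) J : 0 < al -> 0 < t -> 0 <= a ->
  \sum_(j < J) (t * 2 ^+ j < a)%R%:R * (t * 2 ^+ j) `^ al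
    <= (2 `^ al - 1)^-1 * (2 * a) `^ al.
Proof.
move=> al0 t0 a0.
pose f j := Num.min (t * 2 ^+ j) (2 * a) `^ al.
have t_ge0 j : 0 <= t * 2 ^+ j by rewrite mulr_ge0 ?ltW// exprn_gt0.
have c0 : 0 < 2 `^ al - 1 by rewrite subr_gt0 powR2_gt1.
have m0 j : 0 <= Num.min (t * 2 ^+ j) (2 * a).
  by rewrite le_min t_ge0 mulr_ge0.
apply: (@le_trans _ _ (\sum_(j < J) (2 `^ al - 1)^-1 * (f j.+1 - f j))).
  apply: ler_sum => j _; rewrite ler_pdivlMl//.
  have [ja|_] := ltP (t * 2 ^+ j) a; last first.
    rewrite mul0r mulr0 subr_ge0 le_powR ?(ltW al0)//.
    rewrite le_min2// ler_pM2l// exprS ler_peMl ?exprn_ge0// ler1n//.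
  rewrite /f mul1r exprS mulrCA min_l ?ler_wpM2l ?(ltW ja)//.
  rewrite min_l ?(le_trans (ltW ja))// ?ler_peMl ?ler1n//.
  by rewrite (@powRM _ 2)// mulrBl mul1r.
rewrite -mulr_sumr ler_wpM2l ?invr_ge0 ?(ltW c0)//.
rewrite -(big_mkord xpredT (fun j => f j.+1 - f j)) telescope_sumr//.
rewrite lerBlDr ler_wpDr ?powR_ge0// le_powR ?(ltW al0)//.
by rewrite ge_min lexx orbT.
Qed.

(** The same telescoping for the negative powers of the levels above a given
    one. *)
Lemma dyadic_sum_above (be t a : R) J : 0 < be -> 0 < t -> 0 < a ->
  \sum_(j < J) (a <= t * 2 ^+ j)%R%:R * (t * 2 ^+ j) `^ (- be)
    <= (1 - 2 `^ (- be))^-1 * a `^ (- be).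
Proof.
move=> be0 t0 a0.
pose f j := Num.max (t * 2 ^+ j) a `^ (- be).
have t_gt0 j : 0 < t * 2 ^+ j by rewrite mulr_gt0// exprn_gt0.
have c0 : 0 < 1 - (2 : R) `^ (- be).
  by rewrite subr_gt0 powRN invf_lt1 ?powR_gt0// powR2_gt1.
have m0 j : 0 < Num.max (t * 2 ^+ j) a by rewrite lt_max t_gt0.
have anti (x y : R) : 0 < x -> x <= y -> y `^ (- be) <= x `^ (- be).
  move=> x0 xy; rewrite !powRN lef_pV2 ?posrE ?powR_gt0 ?(lt_le_trans x0)//.
  by rewrite le_powR ?(ltW be0) ?(ltW x0).
apply: (@le_trans _ _ (\sum_(j < J) (1 - 2 `^ (- be))^-1 * (f j - f j.+1))).
  apply: ler_sum => j _; rewrite ler_pdivlMl//.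
  have [ja|_] := leP a (t * 2 ^+ j); last first.
    rewrite mul0r mulr0 subr_ge0 anti//.
    rewrite le_max2// ler_pM2l// exprS ler_peMl ?exprn_ge0// ler1n//.
  rewrite /f mul1r exprS mulrCA max_l// max_l; last first.
    by rewrite (le_trans ja)// ler_peMl ?ler1n// (ltW (t_gt0 _)).
  by rewrite (@powRM _ 2) ?(ltW (t_gt0 _))// mulrBl mul1r.
rewrite -mulr_sumr ler_wpM2l ?invr_ge0 ?(ltW c0)//.
rewrite -(big_mkord xpredT (fun j => f j - f j.+1)).
under eq_bigr do rewrite -opprB; rewrite sumrN telescope_sumr// opprB.
rewrite lerBlDr ler_wpDr ?powR_ge0// anti//.
by rewrite le_max lexx orbT.
Qed.

(** The contribution of an entry a to a weak type estimate at level t. *)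
Definition weak_profile s r t a : R :=
  (t < a)%R%:R * (a / t) `^ s + (a <= t)%R%:R * (a / t) `^ r.

Definition layer_cst p s r : R :=
  (2 `^ (p - s) - 1)^-1 * 2 `^ (p - s) + (1 - 2 `^ (p - r))^-1.

(** Since s < p < r, the two geometric series over the levels t are dominated
    by their terms nearest to t = a, which are of order a^p. *)
Lemma weak_profile_sum p s r t a J : 0 <= s -> s < p -> p < r -> 0 < t ->
  0 <= a ->
  \sum_(j < J) (t * 2 ^+ j) `^ p * weak_profile s r (t * 2 ^+ j) a
    <= layer_cst p s r * a `^ p.
Proof.
move=> s0 sp pr t0; rewrite le_eqVlt => /orP[/eqP<-|a0].
  rewrite big1 ?mulr_ge0 ?powR_ge0// => [|j _].
    apply: addr_ge0; rewrite ?mulr_ge0 ?powR_ge0 ?invr_ge0 ?subr_ge0//.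
      by rewrite ltW// powR2_gt1// subr_gt0.
    rewrite -opprB powRN invf_le1 ?powR_gt0// ltW// powR2_gt1// subr_gt0//.
  rewrite /weak_profile !mul0r (@powR0 _ r) ?mulr0 ?addr0; last first.
    by rewrite gt_eqF// (le_lt_trans s0)// (lt_trans sp).
  by rewrite ltNge (ltW (mulr_gt0 _ _)) ?exprn_gt0//= mul0r mulr0.
have t_gt0 j : 0 < t * 2 ^+ j by rewrite mulr_gt0// exprn_gt0.
rewrite /layer_cst mulrDl.
under eq_bigr do rewrite mulrDr; rewrite big_split lerD//=.
  apply: (@le_trans _ _ (a `^ s *
     \sum_(j < J) (t * 2 ^+ j < a)%R%:R * (t * 2 ^+ j) `^ (p - s))).
    rewrite mulr_sumr ler_sum// => j _.
    rewrite powRVM ?(ltW a0) ?(ltW (t_gt0 _))// powRD ?(gt_eqF (t_gt0 _)) ?implybT//.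
    by rewrite le_eqVlt; apply/orP; left; apply/eqP; ring.
  rewrite (le_trans (ler_wpM2l _ (dyadic_sum_below _ _ _ _)))//.
  - exact: powR_ge0.
  - by rewrite subr_gt0.
  - exact: ltW.
  rewrite powRM ?(ltW a0)// !mulrA mulrC !mulrA -powRD ?(gt_eqF a0) ?implybT//.
  rewrite subrK le_eqVlt; apply/orP; left; apply/eqP; ring.
apply: (@le_trans _ _ (a `^ r *
   \sum_(j < J) (a <= t * 2 ^+ j)%R%:R * (t * 2 ^+ j) `^ (- (r - p)))).
  rewrite mulr_sumr ler_sum// => j _.
  rewrite powRVM ?(ltW a0) ?(ltW (t_gt0 _))// opprB powRD ?(gt_eqF (t_gt0 _)) ?implybT//.
  by rewrite le_eqVlt; apply/orP; left; apply/eqP; ring.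
rewrite (le_trans (ler_wpM2l _ (dyadic_sum_above _ _ _ _)))//.
- exact: powR_ge0.
- by rewrite subr_gt0.
rewrite mulrCA -powRD ?(gt_eqF a0) ?implybT//.
by rewrite opprB addrCA subrr addr0.
Qed.

End Layer.

(** * From weak type to strong type *)

Section Interpolation.
Variable R : realType.
Implicit Types (p q : \bar R) (z w : R^nat).

(** Finitely many entries only involve finitely many dyadic levels, starting
    from a positive one. *)
Lemma exists_lower_threshold (b : nat -> R) N :
  exists2 t : R, 0 < t & forall k, (k < N)%N -> 0 < b k -> t < b k.
Proof.
elim: N => [|N [t t0 ht]]; first by exists 1.
exists (if 0 < b N then Num.min t (b N / 2) else t).
  by case: ifP => // bN; rewrite lt_min t0 divr_gt0.
move=> k; rewrite ltnS leq_eqVlt => /orP[/eqP->bN|kN bk].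
  by rewrite bN gt_min; apply/orP; right; rewrite ltr_pdivrMr// mulr_natr mulr2n ltrDl.
by case: ifP => // _; rewrite ?gt_min ht.
Qed.

Lemma exists_pow2_ge (x : R) : exists J, x <= 2 ^+ J.
Proof.
have h := archi_boundP (normr_ge0 x); exists (Num.bound `|x|).
rewrite (le_trans (ler_norm _))// ltW// (lt_trans h)//.
by rewrite -natrX ltr_nat ltn_expl.
Qed.

(** The highest level below b already gives b^p up to a constant; the sum over
    all levels has the advantage of commuting with a sum over entries. *)
Lemma powR_le_dyadic_sum (p K t b : R) J : 0 <= p -> 0 < K -> 0 < t ->
  K * t < b -> b <= K * (t * 2 ^+ J) ->
  b `^ p <= (2 * K) `^ p *
    \sum_(j < J) (t * 2 ^+ j) `^ p * (K * (t * 2 ^+ j) < b)%R%:R.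
Proof.
move=> p0 K0 t0 tb; elim: J => [|J IH].
  by rewrite expr0 mulr1 => /(lt_le_trans tb); rewrite ltxx.
have tJ : 0 < t * 2 ^+ J by rewrite mulr_gt0// exprn_gt0.
move=> bJ; rewrite big_ord_recr/= mulrDr.
have [h|h] := leP b (K * (t * 2 ^+ J)); first by rewrite mulr0 mulr0 addr0 IH.
rewrite ler_wpDl ?mulr_ge0 ?powR_ge0//.
  by apply: sumr_ge0 => j _; rewrite mulr_ge0 ?powR_ge0.
rewrite mulr1 -powRM ?(ltW tJ)//; last by rewrite mulr_ge0// ltW.
apply: le_powR => //.
  by rewrite (le_trans _ (ltW tb))// mulr_ge0 ?ltW.
by rewrite (le_trans bJ)// exprS le_eqVlt; apply/orP; left; apply/eqP; ring.
Qed.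

(** Marcinkiewicz's argument: sum the weak type estimates over dyadic levels and
    exchange the sums. *)
Lemma weak_to_strong (p s r K D : R) w z n N :
  0 <= s -> s < p -> p < r -> 0 < K -> 0 <= D ->
  (forall t, 0 < t -> \sum_(k < N) (K * t < `|w k|)%R%:R
     <= D * \sum_(i < n) weak_profile s r t `|z i|) ->
  \sum_(k < N) `|w k| `^ p
    <= (2 * K) `^ p * D * layer_cst p s r * \sum_(i < n) `|z i| `^ p.
Proof.
move=> s0 sp pr K0 D0 H; have p0 : 0 < p by exact: le_lt_trans sp.
(* t is the lowest level and t * 2 ^+ J the highest one. *)
have [t t0 ht] := exists_lower_threshold (fun k => `|w k| / K) N.
have [J hJ] := exists_pow2_ge (\sum_(k < N) `|w k| / (K * t)).
apply: (@le_trans _ _ ((2 * K) `^ p * \sum_(j < J) (t * 2 ^+ j) `^ p *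
    \sum_(k < N) (K * (t * 2 ^+ j) < `|w k|)%R%:R)).
  under [X in _ <= _ * X]eq_bigr do rewrite mulr_sumr.
  rewrite exchange_big mulr_sumr/=; apply: ler_sum => k _.
  have [->|wk] := eqVneq (w k) 0.
    rewrite normr0 powR0 ?gt_eqF// mulr_ge0 ?powR_ge0// sumr_ge0// => j _.
    by rewrite mulr_ge0 ?powR_ge0.
  apply: powR_le_dyadic_sum; rewrite ?(ltW p0)//.
    by rewrite mulrC -ltr_pdivlMr//; apply: ht => //; rewrite divr_gt0// normr_gt0.
  rewrite mulrA -ler_pdivrMl ?mulr_gt0//; apply: le_trans hJ.
  rewrite mulrC (bigD1 k)//= lerDl sumr_ge0// => j _.
  by rewrite divr_ge0// mulr_ge0 ?ltW.
rewrite -!mulrA ler_wpM2l ?powR_ge0//.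
have tj j : 0 < t * 2 ^+ j by rewrite mulr_gt0// exprn_gt0.
apply: (@le_trans _ _ (D * \sum_(i < n) \sum_(j < J)
    (t * 2 ^+ j) `^ p * weak_profile s r (t * 2 ^+ j) `|z i|)).
  rewrite exchange_big mulr_sumr/=; apply: ler_sum => j _.
  by rewrite -mulr_sumr [leRHS]mulrCA ler_wpM2l ?powR_ge0// H.
rewrite ler_wpM2l// mulr_sumr; apply: ler_sum => i _.
exact: weak_profile_sum.
Qed.

Lemma chebyshev (s t v : R) : 0 <= s -> 0 < t ->
  (t < `|v|)%R%:R <= t `^ (- s) * lpterm s v.
Proof.
move=> s0 t0; case: ltP => [tv|_]; last by rewrite mulr_ge0 ?powR_ge0 ?lpterm_ge0.
have v0 : v != 0 by rewrite -normr_gt0 (lt_trans t0).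
rewrite lpterm_neq0// powRN ler_pdivlMl ?powR_gt0// mulr1.
by apply: le_powR => //; exact: ltW.
Qed.

Lemma lpsum_le_fin (r : R) z n : (forall k, (n <= k)%N -> z k = 0) ->
  lpsum_le r z (\sum_(k < n) lpterm r (z k)).
Proof.
move=> zn N; have [Nn|/ltnW nN] := leqP N n.
  exact: (ge0_sum_ord_le (fun k => lpterm_ge0 r (z k))).
rewrite -!(big_mkord xpredT (fun k => lpterm r (z k))) (big_cat_nat _ nN)//=.
rewrite [X in _ + X]big_nat [X in _ + X]big1 ?addr0// => k /andP[nk _].
by rewrite zn// lpterm0.
Qed.

Lemma lpball_fin p z n : (0 <= p)%E -> (forall k, (n <= k)%N -> z k = 0) ->
  exists B, lpball p z B.
Proof.
case: p => [r||]// _ zn; first by exists (\sum_(k < n) lpterm r (z k)); exact: lpsum_le_fin.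
exists (\sum_(k < n) `|z k|) => k; have [kn|nk] := ltnP k n.
  by rewrite (bigD1 (Ordinal kn))//= lerDl sumr_ge0.
by rewrite zn// normr0 sumr_ge0.
Qed.

(** Split z at height t, apply the bound on l^s to the large entries and the one
    on l^r to the small ones, and count by Chebyshev's inequality. For s = 0 the
    latter counts supports. For r = oo the small entries contribute nothing
    above a multiple of t, so that any finite exponent r' is allowed. *)
Lemma weak_type (T : R^nat -> R^nat) (s : R) (r : \bar R) (r' Cs Cr : R) :
  0 <= s -> 0 <= Cs -> 0 <= Cr -> 0 < r' ->
  (r = r'%:E \/ r = +oo%E) ->
  (forall x y, carrier (lp r) x -> carrier (lp r) y -> T (x + y) = T x + T y) ->
  (forall z B, lpball s%:E z B -> lpball s%:E (T z) (Cs * B)) ->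
  (forall z B, lpball r z B -> lpball r (T z) (Cr * B)) ->
  exists K D, [/\ 0 < K, 0 <= D & forall z n t N,
    (forall k, (n <= k)%N -> z k = 0) -> 0 < t ->
    \sum_(k < N) (K * t < `|T z k|)%R%:R
      <= D * \sum_(i < n) weak_profile s r' t `|z i|].
Proof.
move=> s0 Cs0 Cr0 r'0 rE TD Ts Tr.
have r0 : (0 <= r)%E by case: rE => ->; rewrite ?lee_fin ?ltW.
pose z0 t z : R^nat := fun k => if t < `|z k| then z k else 0.
pose z1 t z : R^nat := fun k => if t < `|z k| then 0 else z k.
have zE t z : z = z0 t z + z1 t z.
  by apply/funext => k; rewrite /z0 /z1 fctE; case: ifP; rewrite ?addr0 ?add0r.
have TE t z n : (forall k, (n <= k)%N -> z k = 0) ->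
    T z = T (z0 t z) + T (z1 t z).
  move=> zn; rewrite {1}(zE t z); apply: TD.
  - by apply/(carrier_lpP _ r0); apply: (@lpball_fin _ _ n) => // k nk; rewrite /z0 zn// if_same.
  - by apply/(carrier_lpP _ r0); apply: (@lpball_fin _ _ n) => // k nk; rewrite /z1 zn// if_same.
have H0 z n t N : (forall k, (n <= k)%N -> z k = 0) -> 0 < t ->
    \sum_(k < N) (t < `|T (z0 t z) k|)%R%:R
      <= Cs * \sum_(i < n) (t < `|z i|)%R%:R * (`|z i| / t) `^ s.
  move=> zn t0.
  have z0n k : (n <= k)%N -> z0 t z k = 0 by move=> nk; rewrite /z0 zn// if_same.
  have := Ts _ _ (lpsum_le_fin s z0n) => /(_ N) h.
  apply: (@le_trans _ _ (\sum_(k < N) t `^ (- s) * lpterm s (T (z0 t z) k))).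
    by apply: ler_sum => k _; exact: chebyshev.
  rewrite -mulr_sumr (le_trans (ler_wpM2l (powR_ge0 _ _) h))//.
  rewrite mulrCA ler_wpM2l// mulr_sumr ler_sum// => i _; rewrite /z0.
  case: ifPn => [ti|_]; last by rewrite lpterm0 mulr0 mul0r.
  have zi0 : z i != 0 by rewrite -normr_gt0 (lt_trans t0).
  by rewrite mul1r lpterm_neq0// powRVM// ?(ltW t0)// mulrC.
have W0 (r1 t : R) z n : 0 < t ->
    0 <= \sum_(i < n) (t < `|z i|)%R%:R * (`|z i| / t) `^ r1 :> R.
  by move=> t0; rewrite sumr_ge0// => i _; rewrite mulr_ge0 ?powR_ge0.
have W1 (r1 t : R) z n : 0 < t ->
    0 <= \sum_(i < n) (`|z i| <= t)%R%:R * (`|z i| / t) `^ r1 :> R.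
  by move=> t0; rewrite sumr_ge0// => i _; rewrite mulr_ge0 ?powR_ge0.
case: rE => rE; last first.
  exists (Cr + 1), Cs; split => //; first by rewrite ltr_wpDl.
  move=> z n t N zn t0; rewrite /weak_profile big_split mulrDr.
  rewrite ler_wpDr ?mulr_ge0 ?W1//; apply: le_trans (H0 _ _ _ _ zn t0).
  apply: ler_sum => k _; rewrite ler_nat.
  case: (ltP ((Cr + 1) * t)) => // h; rewrite lt0n eqb0 -leNgt -ltNge.
  have hz1 : lpball r (z1 t z) t.
    by rewrite rE => i; rewrite /z1; case: ltP => //; rewrite normr0 ltW.
  have := Tr _ _ hz1; rewrite {1}rE => /(_ k) h1.
  move: h; rewrite (TE t z n zn) => /lt_le_trans/(_ (ler_normD _ _)).
  by move: h1; rewrite mulrDl mul1r; lra.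
exists 2, (Cs + Cr); split => //; first exact: addr_ge0.
move=> z n t N zn t0; rewrite /weak_profile big_split/=.
set A := \sum_(i < n) _ * _; set B := \sum_(i < n) _ * _.
have A0 : 0 <= A by exact: W0.
have B0 : 0 <= B by exact: W1.
have HA : _ <= Cs * A := H0 z n t N zn t0.
have z1n k : (n <= k)%N -> z1 t z k = 0 by move=> nk; rewrite /z1 zn// if_same.
have HB : \sum_(k < N) (t < `|T (z1 t z) k|)%R%:R <= Cr * B.
  have := lpsum_le_fin r' z1n; rewrite -[lpsum_le _ _]/(lpball r'%:E _) -rE.
  move=> /Tr; rewrite rE => /(_ N) h.
  apply: (@le_trans _ _ (\sum_(k < N) t `^ (- r') * lpterm r' (T (z1 t z) k))).
    by apply: ler_sum => k _; apply: chebyshev => //; exact: ltW.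
  rewrite -mulr_sumr (le_trans (ler_wpM2l (powR_ge0 _ _) h))//.
  rewrite mulrCA ler_wpM2l// mulr_sumr ler_sum// => i _; rewrite /z1.
  case: (ltP t `|z i|) => [ti|_]; first by rewrite lpterm0 mulr0 mul0r.
  by rewrite mul1r lpterm_pos ?gt_eqF// powRVM// ?(ltW t0)// mulrC.
apply: (@le_trans _ _ (Cs * A + Cr * B)); last first.
  by rewrite mulrDl lerD// ler_wpM2l// ?lerDl ?lerDr.
apply: le_trans (lerD HA HB); rewrite -big_split/=.
apply: ler_sum => k _; rewrite -natrD ler_nat.
case: (ltP (2 * t)) => // h; rewrite lt0n addn_eq0 !eqb0 -!leNgt.
apply/negP => /andP[h0 h1]; move: h; rewrite (TE t z n zn) ltNge.
rewrite (le_trans (ler_normD _ _))// mulr_natl mulr2n lerD//.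
Qed.

End Interpolation.

(** * Inclusions and interpolation between the sequence spaces *)

Section Truncation.
Variable R : realType.
Implicit Types (p q : \bar R) (z w : R^nat) (T : R^nat -> R^nat).

Definition trunc n z : R^nat := fun k => if (k < n)%N then z k else 0.

Lemma lpball_coord p z B k : (0 < p)%E -> lpball p z B -> `|z k| <= lproot p B.
Proof.
case: p => [r||]//=; rewrite lte_fin => r0 zB; have h := lpsum_le_term k zB.
rewrite /fin_lproot gt_eqF// -(@powRr1 _ `|z k|)// -(mulfV (lt0r_neq0 r0)) powRrM.
apply: le_powR; rewrite ?powR_ge0// ?invr_ge0 ?(ltW r0)//.
by rewrite lpterm_pos ?gt_eqF// in h.
Qed.

(** Every entry is at most the l^p size N of w, hence the q-th powers are at most
    N^(q-p) times the p-th ones. *)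
Lemma lpball_sub (p : R) q w B : 0 < p -> (p%:E <= q)%E -> lpball p%:E w B ->
  exists2 B', lpball q w B' & lproot q B' = lproot p%:E B.
Proof.
move=> p0 pq wB; have B0 := lpball_ge0 wB.
have q0 : (0 <= q)%E by rewrite (le_trans _ pq)// lee_fin ltW.
have N0 := lproot_ge0 p%:E B0; have [B' B'0 B'E] := lproot_surj q0 N0.
exists B' => //; have wk k : `|w k| <= lproot q B'.
  by rewrite B'E; exact: lpball_coord wB.
case: q pq q0 B'E wk => [r||]//= rp _ B'E wk N.
rewrite lee_fin in rp; have r0 := lt_le_trans p0 rp.
move: B'E wk; rewrite /fin_lproot !gt_eqF// => B'E wk.
have [w0|/eqP] := eqVneq B 0.
  have -> : w = 0 by apply: (@lpball_eq0 _ p%:E); rewrite -w0.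
  by rewrite big1// => k _; exact: lpterm0.
move=> /eqP Bn0; have BE : B' = B `^ p^-1 `^ r.
  by rewrite -B'E -powRrM mulVf ?gt_eqF// powRr1.
apply: (@le_trans _ _ (\sum_(k < N) lpterm p (w k) * (B `^ p^-1) `^ (r - p))).
  apply: ler_sum => k _; have [->|wk0] := eqVneq (w k) 0.
    by rewrite !lpterm0 mul0r.
  rewrite !lpterm_neq0//.
  have -> : `|w k| `^ r = `|w k| `^ p * `|w k| `^ (r - p).
    by rewrite -powRD ?normr_eq0 ?wk0 ?implybT// subrKC.
  by rewrite ler_wpM2l ?powR_ge0// le_powR ?subr_ge0// -B'E.
rewrite -mulr_suml.
have -> : B' = B * (B `^ p^-1) `^ (r - p).
  rewrite BE -{2}(powRr1 B0) -(mulVf (lt0r_neq0 p0)) powRrM.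
  by rewrite -powRD ?powR_eq0 ?(negPf Bn0) ?implybT// subrKC.
by rewrite ler_wpM2r ?powR_ge0.
Qed.

Lemma lpsum_le0_fin z B : lpsum_le 0 z B ->
  exists n, forall k, (n <= k)%N -> z k = 0.
Proof.
move=> zB; apply: contrapT => /forallNP H.
have {}H n : exists2 k, (n <= k)%N & z k != 0.
  apply: contrapT => h; apply: (H n) => k nk; apply/eqP/negPn/negP => zk.
  by apply: h; exists k.
have large m : exists N, m%:R <= \sum_(k < N) lpterm 0 (z k).
  elim: m => [|m [N hN]]; first by exists 0%N; rewrite big_ord0.
  have [k Nk zk] := H N; exists k.+1; rewrite big_ord_recr /= -natr1 lerD//.
    by rewrite (le_trans hN)// (ge0_sum_ord_le (fun k => lpterm_ge0 0 (z k))).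
  by rewrite lpterm_neq0// powRr0.
have [N hN] := large (Num.bound `|B|); have := archi_boundP (normr_ge0 B).
move=> /(le_lt_trans (ler_norm B)); rewrite ltNge => /negP; apply.
exact: le_trans hN (zB N).
Qed.

Lemma carrier_lp_sub p q : (0 <= p)%E -> (p <= q)%E ->
  carrier (lp p : seq_space R) `<=` carrier (lp q).
Proof.
move=> p0 pq z; have q0 := le_trans p0 pq.
case: p p0 pq => [p||]//; last by move=> _; rewrite leye_eq => /eqP->.
rewrite lee_fin le_eqVlt => /orP[/eqP<- _|p0 pq] /carrier_lpP; last first.
  move=> /(_ (ltW p0))[B /(lpball_sub p0 pq)[B' zB' _]].
  by apply/(carrier_lpP _ q0); exists B'.
move=> /(_ (lexx _))[B /lpsum_le0_fin[n zn]]; apply/(carrier_lpP _ q0).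
exact: lpball_fin zn.
Qed.

(** For p = 0 the topology is discrete: two sequences at distance less than 1
    coincide. *)
Lemma continuous_inclusion_lp p q : (0 <= p)%E -> (p <= q)%E ->
  continuous_inclusion (lp p : seq_space R) (lp q).
Proof.
move=> p0 pq; have q0 := le_trans p0 pq.
split; first exact: carrier_lp_sub.
move=> a pa e e0.
case: p p0 pq pa => [p||]// p0 pq pa; last first.
  by move: pq; rewrite leye_eq => /eqP->; exists e.
move: p0; rewrite lee_fin le_eqVlt => /orP[/eqP p0|p0].
  exists 1 => // x px; rewrite -p0 in px pa *.
  move=> /lt_le_trans h.
  have [B hB BE] := lpball_qnorm (lexx _) (carrier_lpB (lexx _) px pa).
  have B1 : B < 1 by move: BE; rewrite /= /fin_lproot eqxx => ->; exact: h.
  have -> : x - a = 0.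
    apply/funext => k; apply/eqP/negPn/negP => xk.
    have := lpsum_le_term k hB; rewrite lpterm_neq0// powRr0.
    by rewrite leNgt B1.
  by rewrite qnorm_lp0.
exists e => // x px h; apply: le_lt_trans h.
have p0' : (0 <= p%:E)%E by rewrite lee_fin ltW.
have [B hB <-] := lpball_qnorm p0' (carrier_lpB p0' px pa).
have [B' hB' <-] := lpball_sub p0 pq hB; exact: qnorm_lp_le.
Qed.

Lemma continuous_inclusion_trans (X Y Z : seq_space R) :
  continuous_inclusion X Y -> continuous_inclusion Y Z ->
  continuous_inclusion X Z.
Proof.
move=> [XY cXY] [YZ cYZ]; split; first exact: subset_trans YZ.
move=> a Xa e e0; have [d d0 hd] := cYZ a (XY _ Xa) e e0.
have [d' d'0 hd'] := cXY a Xa d d0; exists d' => // x Xx h.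
by apply: hd; [exact: XY|exact: hd'].
Qed.

Lemma linear_map_on0 p T : (0 <= p)%E -> linear_map_on (lp p) T -> T 0 = 0.
Proof.
move=> p0 /(_ (-1) 0 0 (carrier_lp0 p0) (carrier_lp0 p0)).
by rewrite scaler0 addr0 => ->; rewrite scaleN1r addNr.
Qed.

Lemma linear_map_onD p T x y : (0 <= p)%E -> linear_map_on (lp p) T ->
  carrier (lp p) x -> carrier (lp p) y -> T (x + y) = T x + T y.
Proof.
by move=> p0 /(_ 1 x y) H hx hy; have := H hx hy; rewrite !scale1r.
Qed.

Lemma linear_map_onB p T x y : (0 <= p)%E -> linear_map_on (lp p) T ->
  carrier (lp p) x -> carrier (lp p) y -> T (x - y) = T x - T y.
Proof.
move=> p0 /(_ (-1) y x) H hx hy; have := H hy hx.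
by rewrite !scaleN1r ![- _ + _]addrC.
Qed.

Lemma lpsum_tail (p : R) z B (e : R) : 0 < e -> lpsum_le p z B ->
  exists n0, forall n, (n0 <= n)%N -> lpsum_le p (z - trunc n z) e.
Proof.
move=> e0 zB; pose S N := \sum_(k < N) lpterm p (z k).
have Sub : has_sup (range S).
  split; first by exists (S 0%N), 0%N.
  by exists B => _ [N _ <-]; exact: zB.
have [_ [n0 _ <-] hn0] := sup_adherent e0 Sub.
exists n0 => n nn0 N.
have SE : \sum_(k < N) lpterm p ((z - trunc n z) k) <= S (maxn n N) - S n.
  rewrite lerBrDl /S -!(big_mkord xpredT (fun k => lpterm p (z k))).
  rewrite -(big_mkord xpredT (fun k => lpterm p ((z - trunc n z) k))).
  rewrite (@big_cat_nat _ _ _ n 0 (maxn n N))//= ?leq_maxl// lerD2l.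
  have [Nn|nN] := leqP N n.
    rewrite big_nat big1 ?sumr_ge0// => [k _|k /andP[_ kN]]; first exact: lpterm_ge0.
    rewrite /trunc !fctE (leq_trans kN Nn) subrr; exact: lpterm0.
  rewrite (@big_cat_nat _ _ _ n 0 N)//= ?(ltnW nN)//.
  rewrite big_nat big1 ?add0r.
    rewrite le_eqVlt; apply/orP; left; apply/eqP.
    rewrite !big_nat; apply: eq_bigr => k /andP[nk _].
    by rewrite /trunc !fctE ltnNge nk subr0.
  move=> k /andP[_ kn]; rewrite /trunc !fctE kn subrr; exact: lpterm0.
rewrite (le_trans SE)// lerBlDr.
have := ub_le_sup Sub.2 (imageP S I : range S (S (maxn n N))).
have : S n0 <= S n by exact: (ge0_sum_ord_le (fun k => lpterm_ge0 p (z k))).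
by move: hn0; lra.
Qed.

Lemma carrier_trunc p z n : (0 <= p)%E -> carrier (lp p) (trunc n z).
Proof.
move=> p0; apply/(carrier_lpP _ p0); apply: (@lpball_fin _ _ _ n) => // k nk.
by rewrite /trunc ltnNge nk.
Qed.

(** The tail of z is small in l^p, hence in l^q where T is continuous; this gives
    uniform convergence of the entries. *)
Lemma trunc_approx (p : R) q T z (e : R) : 0 < p -> (p%:E <= q)%E ->
  linear_map_on (lp q) T -> bounded_map (lp q) T -> carrier (lp p%:E) z ->
  0 < e -> exists n0, forall n k, (n0 <= n)%N ->
    `|T z k - T (trunc n z) k| <= e.
Proof.
move=> p0 pq Tlin Tb pz e0.
have p0' : (0 <= p%:E)%E by rewrite lee_fin ltW.
have q0 : (0 <= q)%E by exact: le_trans pq.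
have q0' : (0 < q)%E by rewrite (lt_le_trans _ pq)// lte_fin.
have [C C0 TC] := (bounded_lpP q0 (linear_map_on0 q0 Tlin)).1 Tb.
have [B zB] := (carrier_lpP z p0').1 pz.
have [D D0 DE] := lproot_surj q0 (ltW e0).
have [d d0 hd] : exists2 d, 0 < d & lproot q C * lproot p%:E d <= e.
  exists ((e / (lproot q C + 1)) `^ p).
    by rewrite powR_gt0// divr_gt0// ltr_wpDl// lproot_ge0.
  have C1 : 0 < lproot q C + 1 by rewrite ltr_wpDl// lproot_ge0.
  rewrite /= /fin_lproot gt_eqF// -powRrM mulfV ?gt_eqF// powRr1 ?divr_ge0 ?(ltW e0) ?(ltW C1)//.
  rewrite mulrCA ler_piMr ?(ltW e0)// ler_pdivrMr// mul1r lerDl//.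
have [n0 hn0] := lpsum_tail d0 zB; exists n0 => n k /hn0 h.
have [B' hB' BE] := lpball_sub p0 pq h.
have -> : T z k - T (trunc n z) k = T (z - trunc n z) k.
  rewrite (linear_map_onB q0 Tlin) ?fctE//; last exact: carrier_trunc.
  exact: carrier_lp_sub pz.
rewrite (le_trans (lpball_coord k q0' (TC _ _ hB')))//.
by rewrite lprootM ?BE ?(lpball_ge0 hB').
Qed.

(** Passing to the limit costs the constant of the quasi-triangle inequality,
    the error term being arbitrarily small. *)
Lemma lpsum_le_trunc (p : R) q (a : R) T z B : 0 < p -> (p%:E <= q)%E ->
  linear_map_on (lp q) T -> bounded_map (lp q) T -> carrier (lp p%:E) z ->
  0 < a -> (forall n, lpsum_le a (T (trunc n z)) B) ->
  lpsum_le a (T z) (2 `^ a * B).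
Proof.
move=> p0 pq Tlin Tb pz a0 H N; apply/ler_addgt0Pr => eta eta0.
pose d := eta / (2 `^ a * N.+1%:R).
have d0 : 0 < d by rewrite divr_gt0// mulr_gt0// powR_gt0.
have [n0 hn0] := trunc_approx p0 pq Tlin Tb pz (powR_gt0 a^-1 d0).
apply: (@le_trans _ _ (\sum_(k < N) 2 `^ a *
    (lpterm a (T (trunc n0 z) k) + d))).
  apply: ler_sum => k _; rewrite -[T z k](subrKC (T (trunc n0 z) k)).
  rewrite (le_trans (lptermD _ _ (ltW a0)))// ler_wpM2l ?powR_ge0// lerD2l.
  rewrite lpterm_pos ?gt_eqF// -[leRHS](powRr1 (ltW d0)) -(mulVf (lt0r_neq0 a0)).
  rewrite powRrM; apply: le_powR => //; first exact: ltW.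
  exact: hn0.
rewrite -mulr_sumr big_split/= mulrDr lerD//.
  by rewrite ler_wpM2l ?powR_ge0//; exact: H.
rewrite sumr_const card_ord.
apply: (@le_trans _ _ (2 `^ a * (d *+ N.+1))).
  by rewrite ler_wpM2l ?powR_ge0// mulrS lerDr ltW.
rewrite -[d *+ _]mulr_natr /d mulrCA -mulrA mulVf ?mulr1//.
Qed.

(** Truncations reduce the claim to finitely supported sequences, on which the
    weak type estimates can be summed. *)
Lemma interpolation (s p r : \bar R) T : (0 <= s)%E -> (s < p)%E -> (p < r)%E ->
  linear_map_on (lp r) T -> bounded_map (lp s) T -> bounded_map (lp r) T ->
  bounded_map (lp p) T.
Proof.
move=> s0 sp pr Tlin Ts Tr.
have p0 := le_lt_trans s0 sp; have r0 := ltW (lt_trans p0 pr).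
have T0 := linear_map_on0 r0 Tlin.
have [Cs Cs0 TsC] := (bounded_lpP s0 T0).1 Ts.
have [Cr Cr0 TrC] := (bounded_lpP r0 T0).1 Tr.
case: p sp pr p0 => [p||]//; last by move=> _; rewrite ltNge leey.
case: s s0 Ts TsC => [s||]//; rewrite lee_fin => s0 Ts TsC.
rewrite !lte_fin => sp pr p0.
have [r' [pr' r'E]] : exists r', p < r' /\ (r = r'%:E \/ r = +oo%E).
  case: r pr {r0 Tr TrC Tlin} => [r||]// pr; first by exists r; split => //; left.
  by exists (p + 1); rewrite ltrDl; split => //; right.
have TD x y : carrier (lp r) x -> carrier (lp r) y -> T (x + y) = T x + T y.
  exact: linear_map_onD.
have [K [D [K0 D0 H]]] :=
  weak_type s0 Cs0 Cr0 (lt_trans p0 pr') r'E TD TsC TrC.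
have p0' : (0 <= p%:E)%E by rewrite lee_fin ltW.
apply/(bounded_lpP p0' T0).
have lc0 : 0 <= layer_cst p s r'.
  apply: addr_ge0; rewrite ?mulr_ge0 ?powR_ge0 ?invr_ge0 ?subr_ge0//.
    by rewrite ltW// powR2_gt1// subr_gt0.
  rewrite -opprB powRN invf_le1 ?powR_gt0// ltW// powR2_gt1// subr_gt0//.
pose C := (2 * K) `^ p * D * layer_cst p s r'.
have C0 : 0 <= C by rewrite !mulr_ge0// powR_ge0.
exists (2 `^ p * C) => [|z B zB]; first by rewrite mulr_ge0// powR_ge0.
have pz : carrier (lp p%:E) z by apply/(carrier_lpP _ p0'); exists B.
rewrite -mulrA; apply: (lpsum_le_trunc p0 (ltW pr)) => // n N.
under eq_bigr do rewrite lpterm_pos ?gt_eqF//.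
have zn k : (n <= k)%N -> trunc n z k = 0 by move=> nk; rewrite /trunc ltnNge nk.
rewrite (le_trans (weak_to_strong s0 sp pr' K0 D0 (fun t => H _ n t N zn)))//.
rewrite ler_wpM2l// (le_trans _ (zB n))// ler_sum// => k _.
by rewrite /trunc ltn_ord lpterm_pos// gt_eqF.
Qed.

Lemma bounded_operators_interpolation (s p q : \bar R) :
  (0 <= s)%E -> (s < p)%E -> (p < q)%E ->
  bounded_operators s q `<=` (@bounded_operators R p q).
Proof.
by move=> s0 sp pq T [Tlin Tq Ts]; split => //; exact: interpolation sp pq _ _ _.
Qed.

Lemma bounded_operators_interpolationr (p q r : \bar R) :
  (0 <= p)%E -> (p < q)%E -> (q < r)%E ->
  bounded_operators p r `<=` (@bounded_operators R p q).
Proof.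
move=> p0 pq qr T [Tlin Tr Tp]; split => //.
- have qr' := carrier_lp_sub (ltW (le_lt_trans p0 pq)) (ltW qr).
  by move=> a x y /qr' hx /qr' hy; exact: Tlin.
- exact: interpolation pq qr _ _ _.
Qed.

Lemma Int_sub (s p q r : \bar R) : (0 <= s)%E -> (s < p)%E -> (p < q)%E ->
  (q < r)%E -> Int p q `<=` Int s q `&` @Int R p r.
Proof.
move=> s0 sp pq qr E [qbE pE Eq TE].
have p0 := ltW (le_lt_trans s0 sp).
split; split => //.
- exact: continuous_inclusion_trans (continuous_inclusion_lp s0 (ltW sp)) pE.
- by move=> T /(bounded_operators_interpolation s0 sp pq); exact: TE.
- apply: continuous_inclusion_trans Eq _; apply: continuous_inclusion_lp (ltW qr).
  exact: ltW (le_lt_trans p0 pq).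
- by move=> T /(bounded_operators_interpolationr p0 pq qr); exact: TE.
Qed.

End Truncation.

(** * The closed graph theorem for quasi-Banach sequence spaces *)

Section ClosedGraph.
Variable R : realType.
Implicit Types (E : seq_space R) (x y u v w : R^nat) (T : R^nat -> R^nat).

Lemma quasi_banach_linear E : is_quasi_banach E ->
  carrier E 0 /\ forall (a : R) x y, carrier E x -> carrier E y ->
    carrier E (a *: x + y).
Proof.
move=> [[E0 Elin] _ _]; split; first exact: set_mem E0.
move=> a x y Ex Ey; apply: set_mem; apply: Elin; exact: mem_set.
Qed.

Section QuasiBanach.
Variable E : seq_space R.
Hypothesis qbE : is_quasi_banach E.
Let N := qnorm E.

Lemma qb0 : carrier E 0. Proof. exact: (quasi_banach_linear qbE).1. Qed.

Lemma qbD x y : carrier E x -> carrier E y -> carrier E (x + y).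
Proof.
by move=> Ex Ey; rewrite -(scale1r x); exact: (quasi_banach_linear qbE).2.
Qed.

Lemma qbZ (a : R) x : carrier E x -> carrier E (a *: x).
Proof.
move=> Ex; rewrite -(addr0 (a *: x)).
by apply: (quasi_banach_linear qbE).2 => //; exact: qb0.
Qed.

Lemma qbB x y : carrier E x -> carrier E y -> carrier E (x - y).
Proof. by move=> Ex Ey; apply: qbD => //; rewrite -scaleN1r; exact: qbZ. Qed.

Lemma qb_ge0 x : carrier E x -> 0 <= N x.
Proof. by case: qbE => _ [h _ _ _] _; exact: h. Qed.

Lemma qb_norm0 : N 0 = 0.
Proof. by case: qbE => _ [_ h _ _] _; exact: (h 0 qb0).2. Qed.

Lemma qb_gt0 x : carrier E x -> x != 0 -> 0 < N x.
Proof.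
case: qbE => _ [_ h _ _] _ Ex x0; rewrite lt_neqAle qb_ge0// andbT eq_sym.
by apply: contra_neq x0 => /(h x Ex).
Qed.

Lemma qb_normZ (a : R) x : carrier E x -> N (a *: x) = `|a| * N x.
Proof. by case: qbE => _ [_ _ h _] _; exact: h. Qed.

Lemma qb_normN x : carrier E x -> N (- x) = N x.
Proof. by move=> Ex; rewrite -scaleN1r qb_normZ// normrN1 mul1r. Qed.

Lemma qb_normBC x y : carrier E x -> carrier E y -> N (x - y) = N (y - x).
Proof. by move=> Ex Ey; rewrite -(opprB y x) qb_normN//; exact: qbB. Qed.

Lemma qb_triangle : exists2 K : R, 1 <= K &
  forall x y, carrier E x -> carrier E y -> N (x + y) <= K * (N x + N y).
Proof.
case: qbE => _ [_ _ _ [K h]] _; exists (Num.max K 1).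
  by rewrite le_max lexx orbT.
move=> x y Ex Ey; rewrite (le_trans (h _ _ Ex Ey))// ler_wpM2r//.
  by rewrite addr_ge0 ?qb_ge0.
by rewrite le_max lexx.
Qed.

Variable T : R^nat -> R^nat.
Hypothesis TE : forall x, carrier E x -> carrier E (T x).
Hypothesis TB : forall x y, carrier E x -> carrier E y -> T (x - y) = T x - T y.
Hypothesis TZ : forall (a : R) x, carrier E x -> T (a *: x) = a *: T x.

Let T0 : T 0 = 0.
Proof. by rewrite -(subrr 0) TB ?subrr//; exact: qb0. Qed.

(** The Baire step: E is covered by the sets where N (T x) <= n, so one of them
    is dense in some ball. Otherwise shrinking balls avoiding all of them would
    have a common point. *)
Lemma baire_dense_ball : exists (n : nat) a (rho : R), [/\ carrier E a, 0 < rho &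
  forall x, carrier E x -> N (x - a) < rho -> forall e : R, 0 < e ->
    exists v, [/\ carrier E v, N (x - v) < e & N (T v) <= n%:R]].
Proof.
have [K K1 tri] := qb_triangle; have K0 : 0 < K by exact: lt_le_trans K1.
apply: contrapT => H.
have step n a (rho : R) : carrier E a -> 0 < rho -> exists x (e : R),
    [/\ carrier E x, N (x - a) < rho, 0 < e &
      forall v, carrier E v -> N (x - v) < e -> n%:R < N (T v)].
  move=> Ea rho0; apply: contrapT => h; apply: H; exists n, a, rho; split => //.
  move=> x Ex xa e e0; apply: contrapT => h'; apply: h; exists x, e; split => //.
  move=> v Ev xv; rewrite ltNge; apply/negP => hv; apply: h'.
  by exists v; split.
(* A limit of centers with radii rho n decreasing by factors 2 K stays within
   3 K^2 rho n of the n-th center, whence the radius on the last line. *)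
pose good (n : nat) (c c' : R^nat * R) := carrier E c.1 -> 0 < c.2 ->
  [/\ carrier E c'.1, 0 < c'.2, N (c'.1 - c.1) < c.2, c'.2 <= c.2 / (2 * K) &
    forall v, carrier E v -> N (c'.1 - v) < 3 * K ^+ 2 * c'.2 -> n%:R < N (T v)].
have /choice[nx nxP] : forall nc : nat * (R^nat * R), exists c', good nc.1 nc.2 c'.
  move=> [n [a rho]]; have [[Ea rho0]|h] := pselect (carrier E a /\ 0 < rho); last first.
    by exists (a, rho) => Ea rho0; case: h.
  have [x [e [Ex xa e0 hv]]] := step n a rho Ea rho0.
  exists (x, Num.min (rho / (2 * K)) (e / (3 * K ^+ 2))) => _ _ /=.
  split => //.
  - by rewrite lt_min !divr_gt0 ?mulr_gt0 ?exprn_gt0.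
  - by rewrite ge_min lexx.
  - move=> v Ev h; apply: hv => //; apply: lt_le_trans h _.
    rewrite mulrC -ler_pdivlMr ?mulr_gt0 ?exprn_gt0//.
    by rewrite ge_min lexx orbT.
pose c := fix c n := if n is m.+1 then nx (m, c m) else (0 : R^nat, 1 : R).
have cP n : carrier E (c n).1 /\ 0 < (c n).2.
  elim: n => [|n [Ea rho0]]; first by split; [exact: qb0|exact: ltr01].
  by have [? ? _ _ _] := nxP (n, c n) Ea rho0.
have cS n := nxP (n, c n) (cP n).1 (cP n).2; rewrite /= in cS.
pose a n := (c n).1; pose rho n := (c n).2.
have Ea n : carrier E (a n) := (cP n).1.
have rho_gt0 n : 0 < rho n := (cP n).2.
have dist n k : N (a (n + k)%N - a n) <= 2 * K * rho n.
  elim: k n => [|k IH] n.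
    by rewrite addn0 subrr qb_norm0 !mulr_ge0 ?ltW// (ltW K0).
  have [_ _ h1 h2 _] := cS n; rewrite -/(a n.+1) -/(a n) -/(rho n) -/(rho n.+1) in h1 h2.
  rewrite addnS -addSn -(subrKA (a n.+1)).
  rewrite (le_trans (tri _ _ (qbB (Ea _) (Ea _)) (qbB (Ea _) (Ea _))))//.
  rewrite (mulrC 2) -mulrA ler_pM2l// mulr_natl mulr2n lerD//; last exact: ltW.
  rewrite (le_trans (IH n.+1))// mulrC -ler_pdivlMr//.
  by rewrite mulr_gt0.
have [b Eb bcvg] : exists2 x, carrier E x & N (a n - x) @[n --> \oo] --> 0.
  case: qbE => _ _; apply => // e e0.
  have rho_small m : rho m <= 2^-1 ^+ m.
    elim: m => [|m IH]; first by rewrite expr0.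
    have [_ _ _ h2 _] := cS m; rewrite -/(rho m.+1) -/(rho m) in h2.
    rewrite (le_trans h2)// exprSr ler_pM ?(ltW (rho_gt0 _)) ?invr_ge0 ?mulr_ge0 ?(ltW K0)//.
    by rewrite lef_pV2 ?posrE ?mulr_gt0// ler_peMr.
  have [J hJ] := exists_pow2_ge (4 * K ^+ 2 / e + 1).
  exists J => m n Jm Jn.
  have bnd k : (J <= k)%N -> N (a k - a J) <= 2 * K * rho J.
    by move=> Jk; rewrite -(subnKC Jk); exact: dist.
  rewrite -(subrKA (a J)).
  rewrite (le_lt_trans (tri _ _ (qbB (Ea _) (Ea _)) (qbB (Ea _) (Ea _))))//.
  rewrite (qb_normBC (Ea J) (Ea n)).
  apply: (@le_lt_trans _ _ (K * (2 * K * rho J + 2 * K * rho J))).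
    by rewrite ler_wpM2l ?(ltW K0)// lerD ?bnd.
  apply: (@le_lt_trans _ _ (4 * K ^+ 2 * 2^-1 ^+ J)).
    rewrite [leLHS](_ : _ = 4 * K ^+ 2 * rho J); last by ring.
    by rewrite ler_wpM2l ?mulr_ge0 ?exprn_ge0 ?(ltW K0).
  rewrite exprVn ltr_pdivrMr ?exprn_gt0// [ltRHS]mulrC -ltr_pdivrMr//.
  by apply: lt_le_trans hJ; rewrite ltrDl.
have Nb n : N (a n - b) < 3 * K ^+ 2 * rho n.
  have e0 : 0 < K * rho n by rewrite mulr_gt0.
  have /cvgrPdist_lt/(_ _ e0)[M _ hM] := bcvg.
  have := hM (n + M)%N (leq_addl _ _); rewrite /= sub0r normrN.
  rewrite ger0_norm ?qb_ge0//; last exact: qbB.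
  move=> h; rewrite -(subrKA (a (n + M)%N)).
  rewrite (le_lt_trans (tri _ _ (qbB (Ea _) (Ea _)) (qbB (Ea _) Eb)))//.
  rewrite [ltRHS](_ : _ = K * (2 * K * rho n + K * rho n)); last by ring.
  rewrite ltr_pM2l// ler_ltD// qb_normBC//; exact: dist.
have : forall n : nat, n%:R < N (T b).
  move=> n; have [_ _ _ _ h] := cS n; apply: h => //; exact: Nb n.+1.
move=> /(_ (Num.bound (N (T b)))); rewrite ltNge => /negP; apply.
by rewrite ltW// archi_boundP// qb_ge0//; exact: TE.
Qed.

(** Translating the ball to the origin and scaling, every point is approximated
    by points whose images are controlled. *)
Lemma dense_control : exists2 L : R, 0 <= L & forall x, carrier E x ->
  forall e : R, 0 < e ->
    exists v, [/\ carrier E v, N (x - v) < e & N (T v) <= L * N x].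
Proof.
have [K K1 tri] := qb_triangle; have K0 : 0 < K by exact: lt_le_trans K1.
have [n [a [rho [Ea rho0 H]]]] := baire_dense_ball.
have ball x : carrier E x -> N x < rho -> forall e : R, 0 < e ->
    exists v, [/\ carrier E v, N (x - v) < e & N (T v) <= K * (n%:R + n%:R)].
  move=> Ex xrho e e0.
  have e0' : 0 < e / (2 * K) by rewrite divr_gt0// mulr_gt0.
  have [|v1 [Ev1 h1 k1]] := H (x + a) (qbD Ex Ea) _ _ e0'; first by rewrite addrK.
  have [|v2 [Ev2 h2 k2]] := H a Ea _ _ e0'; first by rewrite subrr qb_norm0.
  exists (v1 - v2); split; first exact: qbB.
    rewrite (_ : x - _ = (x + a - v1) + (v2 - a)); last first.
      by apply/funext => k; rewrite !fctE; ring.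
    rewrite (le_lt_trans (tri _ _ (qbB (qbD Ex Ea) Ev1) (qbB Ev2 Ea)))//.
    rewrite (qb_normBC Ev2 Ea) mulrC -ltr_pdivlMr//.
    rewrite [ltRHS](_ : _ = e / (2 * K) + e / (2 * K)) ?ltrD//.
    by field; rewrite gt_eqF.
  rewrite TB// (le_trans (tri _ _ (TE Ev1) _))//.
    by rewrite -scaleN1r; apply: qbZ; exact: TE.
  by rewrite qb_normN ?ler_pM2l ?lerD//; exact: TE.
exists (2 * (K * (n%:R + n%:R)) / rho).
  by rewrite divr_ge0 ?(ltW rho0)// !mulr_ge0// (ltW K0).
move=> x Ex e e0; have [->|x0] := eqVneq x 0.
  by exists 0; rewrite subr0 T0 qb_norm0 mulr0; split => //; exact: qb0.
have Nx0 := qb_gt0 Ex x0.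
pose l := 2 * N x / rho; have l0 : 0 < l by rewrite divr_gt0// mulr_gt0.
have := ball (l^-1 *: x) (qbZ _ Ex) _ (e / l) (divr_gt0 e0 l0).
rewrite qb_normZ// ger0_norm ?invr_ge0 ?(ltW l0)//.
have -> : l^-1 * N x < rho.
  rewrite /l invf_div [ltLHS](_ : _ = rho / 2).
    by rewrite ltr_pdivrMr// mulr_natr mulr2n ltrDl.
  by field; rewrite gt_eqF.
move=> /(_ isT)[v [Ev hv kv]]; exists (l *: v); split; first exact: qbZ.
  have -> : x - l *: v = l *: (l^-1 *: x - v).
    by rewrite scalerBr scalerA mulfV ?scale1r// gt_eqF.
  rewrite qb_normZ ?gtr0_norm// -?ltr_pdivlMl// 1?mulrC//.
  by apply: qbB => //; exact: qbZ.
rewrite TZ// qb_normZ ?gtr0_norm//; last exact: TE.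
rewrite (le_trans (ler_wpM2l (ltW l0) kv))// /l le_eqVlt; apply/orP; left.
by apply/eqP; ring.
Qed.

Hypothesis closedT : forall (u : nat -> R^nat) x w, (forall n, carrier E (u n)) ->
  carrier E x -> carrier E w ->
  N (u n - x) @[n --> \oo] --> 0 -> N (T (u n) - w) @[n --> \oo] --> 0 ->
  w = T x.

(** Successive approximation writes x as the sum of a series whose images decay
    geometrically. The ratio (2 K)^-1 makes up for the factor K lost at each use
    of the quasi-triangle inequality. *)
Lemma closed_graph_bounded : bounded_map E T.
Proof.
have [K K1 tri] := qb_triangle; have K0 : 0 < K by exact: lt_le_trans K1.
have [L L0 HL] := dense_control.
apply/bounded_mapP => //; first exact: qb_gt0.
  exact: qb_norm0.
exists (K * (1 + 2 * K * L)).
  by rewrite mulr_ge0 ?(ltW K0)// addr_ge0// !mulr_ge0// ltW.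
move=> x Ex; split; first exact: TE.
have [->|x0] := eqVneq x 0; first by rewrite T0 [qnorm _ _]qb_norm0 mulr0.
have Nx0 := qb_gt0 Ex x0.
have /choice[f fP] : forall ye : R^nat * R, exists v, carrier E ye.1 -> 0 < ye.2 ->
    [/\ carrier E v, N (ye.1 - v) < ye.2 & N (T v) <= L * N ye.1].
  move=> [y e]; have [[Ey e0]|h] := pselect (carrier E y /\ 0 < e).
    by have [v hv] := HL y Ey e e0; exists v.
  by exists y => Ey e0; case: h.
pose eta := (2 * K)^-1; have eta0 : 0 < eta by rewrite invr_gt0 mulr_gt0.
pose r := fix r i := if i is j.+1 then r j - f (r j, N x * eta ^+ i) else x.
have e0 i : 0 < N x * eta ^+ i by rewrite mulr_gt0// exprn_gt0.
have rP i : carrier E (r i) /\ N (r i) <= N x * eta ^+ i.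
  elim: i => [|i [Er _]]; first by rewrite expr0 mulr1.
  have [/= Ev hv _] := fP (r i, N x * eta ^+ i.+1) Er (e0 i.+1).
  by split; [exact: qbB|exact: ltW].
have Er i : carrier E (r i) := (rP i).1.
pose V m := x - r m.
have EV m : carrier E (V m) by exact: qbB.
have ETV m : carrier E (T (V m)) by exact: TE.
have TV m k : N (T (V (m + k)%N) - T (V m)) <= 2 * K * L * N x * eta ^+ m.
  elim: k m => [|k IH] m.
    by rewrite addn0 subrr qb_norm0 !mulr_ge0 ?exprn_ge0 ?(ltW K0) ?(ltW Nx0) ?(ltW eta0).
  rewrite addnS -addSn -(subrKA (T (V m.+1))).
  rewrite (le_trans (tri _ _ (qbB (ETV _) (ETV _)) (qbB (ETV _) (ETV _))))//.
  have [/= Ev hv kv] := fP (r m, N x * eta ^+ m.+1) (Er m) (e0 m.+1).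
  rewrite [leRHS](_ : _ = K * (2 * K * L * N x * eta ^+ m.+1 + L * (N x * eta ^+ m))).
    rewrite ler_pM2l// lerD ?IH// -TB//.
    rewrite (_ : V m.+1 - V m = f (r m, N x * eta ^+ m.+1)); last first.
      by apply/funext => j; rewrite /V /= !fctE; ring.
    by rewrite (le_trans kv)// ler_wpM2l// (rP m).2.
  by rewrite exprS /eta; field; rewrite gt_eqF.
have eta_cvg : eta ^+ m @[m --> \oo] --> 0.
  apply: cvg_expr; rewrite gtr0_norm// invf_lt1 ?mulr_gt0//.
  by rewrite (lt_le_trans (_ : 1 < 2))// ?ltr1n// ler_peMr.
have etaC (c : R) : c * eta ^+ m @[m --> \oo] --> 0.
  by rewrite -[X in _ --> X](mulr0 c); apply: cvgMl_tmp.
have [w Ew wcvg] : exists2 w, carrier E w & N (T (V n) - w) @[n --> \oo] --> 0.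
  case: qbE => _ _; apply => // e e1.
  have /cvgrPdist_lt/(_ _ e1)[J _ hJ] := etaC (K * (2 * K * L * N x + 2 * K * L * N x)).
  exists J => m n Jm Jn.
  have bnd k : (J <= k)%N -> N (T (V k) - T (V J)) <= 2 * K * L * N x * eta ^+ J.
    by move=> Jk; rewrite -(subnKC Jk); exact: TV.
  rewrite -(subrKA (T (V J))).
  rewrite (le_lt_trans (tri _ _ (qbB (ETV _) (ETV _)) (qbB (ETV _) (ETV _))))//.
  rewrite (qb_normBC (ETV J) (ETV n)).
  apply: (@le_lt_trans _ _ (K * (2 * K * L * N x + 2 * K * L * N x) * eta ^+ J)).
    by rewrite -mulrA ler_pM2l// mulrDl lerD ?bnd.
  by have := hJ J (leqnn J); rewrite /= sub0r normrN => /(le_lt_trans (ler_norm _)).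
have Vx : N (V n - x) @[n --> \oo] --> 0.
  apply: (@squeeze_cvgr _ _ _ _ (cst 0) (fun n => N x * eta ^+ n)) => //.
  - apply: nearW => n; rewrite qb_ge0 //=; last exact: qbB.
    by rewrite /V addrC addKr qb_normN// (rP n).2.
  - exact: cvg_cst.
have -> := esym (closedT EV Ex Ew Vx wcvg).
have /cvgrPdist_lt/(_ _ Nx0)[M _ /(_ M (leqnn M))/=] := wcvg.
rewrite sub0r normrN ger0_norm; last by apply: qb_ge0; exact: qbB.
move=> hM.
rewrite -/(N w) -/(N x) -[w](subKr (T (V M))).
rewrite (_ : T (V M) - _ = (w - T (V M)) + (T (V M) - T (V 0%N))); last first.
  rewrite (_ : V 0%N = 0) ?T0; last by rewrite /V subrr.
  by rewrite subr0; apply/funext => k; rewrite !fctE; ring.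
rewrite (le_trans (tri _ _ (qbB Ew (ETV _)) (qbB (ETV _) (ETV _))))//.
rewrite -mulrA ler_pM2l// mulrDl mul1r lerD//.
  by rewrite qb_normBC// ltW.
by have := TV 0%N M; rewrite add0n expr0 mulr1.
Qed.

End QuasiBanach.

(** Convergence in E implies convergence in l^q, where T is continuous and limits
    are unique: the graph of T in E is closed. *)
Lemma closed_graph E (q : \bar R) T : (0 < q)%E -> is_quasi_banach E ->
  continuous_inclusion E (lp q) -> linear_map_on (lp q) T ->
  bounded_map (lp q) T -> (forall x, carrier E x -> carrier E (T x)) ->
  bounded_map E T.
Proof.
move=> q0 qbE [Eq cEq] Tlin Tb TE; have q0' := ltW q0.
have T0 := linear_map_on0 q0' Tlin.
apply: closed_graph_bounded => //.
- by move=> x y /Eq qx /Eq qy; exact: linear_map_onB Tlin qx qy.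
- move=> a x /Eq qx; have := Tlin a x 0 qx (carrier_lp0 q0').
  by rewrite !addr0 T0 addr0.
move=> u x w Eu Ex Ew ux Tuw.
have [C C0 TC] := (bounded_lpP q0' T0).1 Tb.
have coord (v b : R^nat) (e : R) : carrier E v -> carrier E b -> 0 < e ->
    qnorm (lp q) (v - b) < e -> exists2 B, lpball q (v - b) B & lproot q B < e.
  move=> Ev Eb e0 h; have := carrier_lpB q0' (Eq _ Ev) (Eq _ Eb).
  by move=> /(lpball_qnorm q0')[B vB BE]; exists B; rewrite ?BE.
apply/funext => k; apply/eqP; rewrite eq_sym -subr_eq0 -normr_le0.
apply/ler_addgt0Pr => e e0; rewrite add0r.
pose e1 := e / (lproot q C + 2).
have C2 : 0 < lproot q C + 2 by rewrite ltr_wpDl// lproot_ge0.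
have e10 : 0 < e1 by rewrite divr_gt0.
have [d d0 hd] := cEq x Ex e1 e10.
have [d' d'0 hd'] := cEq w Ew e1 e10.
move: ux Tuw => /cvgrPdist_lt/(_ _ d0)[M _ hM] /cvgrPdist_lt/(_ _ d'0)[M' _ hM'].
have := hM (M + M')%N (leq_addr _ _); have := hM' (M + M')%N (leq_addl _ _).
set n := (M + M')%N; rewrite /= !sub0r !normrN.
move=> /(le_lt_trans (ler_norm _))/(hd' _ (TE _ (Eu n))) h1.
move=> /(le_lt_trans (ler_norm _))/(hd _ (Eu n)) h2.
have [B1 b1 B1e] := coord _ _ _ (TE _ (Eu n)) Ew e10 h1.
have [B2 b2 B2e] := coord _ _ _ (Eu n) Ex e10 h2.
have k1 := lpball_coord k q0 b1; have k2 := lpball_coord k q0 (TC _ _ b2).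
rewrite lprootM ?(lpball_ge0 b2)// (linear_map_onB q0' Tlin) in k2; last 2 first.
- exact: Eq.
- exact: Eq.
rewrite (_ : T x k - w k = (T (u n) - w) k - (T (u n) - T x) k); last first.
  by rewrite !fctE; ring.
rewrite (le_trans (ler_normB _ _))//.
apply: (@le_trans _ _ (e1 + lproot q C * e1)).
  apply: lerD; first by rewrite (le_trans k1)// ltW.
  by rewrite (le_trans k2)// ler_wpM2l ?lproot_ge0// ltW.
rewrite -[X in X + _]mul1r -mulrDl /e1 mulrCA ler_piMr ?(ltW e0)//.
by rewrite ler_pdivrMr// mul1r addrC lerD2l ler1n.
Qed.

End ClosedGraph.

(** * Decreasing rearrangements and tails *)

Section Rearrangement.
Variable R : realType.
Implicit Types (w : nat -> R).

Lemma exists_max_notin w (s : seq nat) : (forall k, 0 <= w k) ->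
  (forall e : R, 0 < e -> exists n, forall k, (n <= k)%N -> w k < e) ->
  (forall n, exists2 k, (n <= k)%N & w k != 0) ->
  exists m, [/\ m \notin s, 0 < w m & forall k, k \notin s -> w k <= w m].
Proof.
move=> w0 wlim winf.
have [k0 k0s wk0] : exists2 k0, k0 \notin s & 0 < w k0.
  have [k sk wk] := winf (\max_(i <- s) i.+1).
  exists k; last by rewrite lt_neqAle eq_sym wk w0.
  apply/negP => ks; have := @leq_bigmax_seq _ s xpredT succn k ks isT.
  by move=> /leq_trans/(_ sk); rewrite ltnn.
have [n hn] := wlim _ wk0.
have k0n : (k0 < n)%N.
  by rewrite ltnNge; apply/negP => /hn; rewrite ltxx.
case: (@arg_maxP _ R 'I_n (Ordinal k0n)
  (fun i : 'I_n => val i \notin s) (fun i => w (val i)) k0s) => m ms mmax.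
exists (val m); split => //; first exact: lt_le_trans (mmax (Ordinal k0n) k0s).
move=> k ks; have [kn|nk] := ltnP k n; first exact: (mmax (Ordinal kn) ks).
by rewrite (le_trans (ltW (hn _ nk)))//; exact: (mmax (Ordinal k0n) k0s).
Qed.

(** Decreasing rearrangement, by repeatedly picking a largest entry among the
    remaining ones. *)
Lemma decreasing_rearrangement w : (forall k, 0 <= w k) ->
  (forall e : R, 0 < e -> exists n, forall k, (n <= k)%N -> w k < e) ->
  (forall n, exists2 k, (n <= k)%N & w k != 0) ->
  exists sg : nat -> nat, [/\ injective sg, forall k, 0 < w (sg k),
    forall i j, (i <= j)%N -> w (sg j) <= w (sg i)
    & forall n, 0 < w n -> exists k, sg k = n].
Proof.
move=> w0 wlim winf.
have /choice[g gP] := fun s => exists_max_notin s w0 wlim winf.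
pose l := fix l k := if k is j.+1 then g (l j) :: l j else [::].
pose sg k := g (l k).
have lsub i j : (i <= j)%N -> {subset l i <= l j}.
  elim: j => [|j IH]; first by rewrite leqn0 => /eqP->.
  rewrite leq_eqVlt => /orP[/eqP->//|/IH h] m /h lm.
  by rewrite /= inE lm orbT.
have sgin i j : (i < j)%N -> sg i \in l j.
  by move=> ij; apply: (lsub i.+1 j ij); rewrite /= inE eqxx.
have sgneq i j : (i < j)%N -> sg i <> sg j.
  move=> /sgin + e; rewrite e => /negP; apply.
  by have [/negP] := gP (l j).
have sginj : injective sg.
  by move=> i j ij; have [/sgneq/(_ ij)|/sgneq/(_ (esym ij))|] := ltngtP i j.
exists sg; split => //.
- by move=> k; have [] := gP (l k).
- move=> i j ij; have [_ _] := gP (l i); apply.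
  by apply: contra (lsub _ _ ij _) _; have [] := gP (l j).
- move=> n wn; apply: contrapT => /forallNP nsg.
  have nl k : n \notin l k.
    elim: k => // k IH; rewrite /= inE negb_or IH andbT; apply/eqP => h.
    by apply: (nsg k).
  have [m hm] := wlim _ wn.
  have sgm k : (sg k < m)%N.
    rewrite ltnNge; apply/negP => /hm; rewrite ltNge => /negP; apply.
    by have [_ _] := gP (l k); apply.
  have := @uniq_leq_size _ (map sg (iota 0 m.+1)) (iota 0 m).
  rewrite map_inj_uniq// iota_uniq size_map !size_iota ltnn => h.
  suff : false by [].
  apply: h => // k /mapP[j _ ->]; rewrite mem_iota add0n; exact: sgm.
Qed.

End Rearrangement.

Section Tails.
Variable R : realType.
Implicit Types (w t : nat -> R).

(** t n is the sum of the terms of w from rank n on. *)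
Definition tail_of w t : Prop := [/\ forall n, 0 <= t n,
  forall n, t n = w n + t n.+1 & forall e : R, 0 < e -> exists n, t n < e].

Lemma exists_tail w (B : R) : (forall k, 0 <= w k) ->
  (forall N, \sum_(k < N) w k <= B) -> exists t, tail_of w t.
Proof.
move=> w0 wB; pose S N := \sum_(k < N) w k.
have Sub : has_sup (range S).
  by split; [exists (S 0%N), 0%N|exists B => _ [N _ <-]; exact: wB].
exists (fun n => sup (range S) - S n); split => [n|n|e e0].
- by rewrite subr_ge0; exact: (ub_le_sup Sub.2 (imageP S I : range S (S n))).
- by rewrite /S big_ord_recr/=; ring.
- have [_ [n _ <-] h] := sup_adherent e0 Sub; exists n.
  by move: h; rewrite ltrBlDr ltrBlDl addrC.
Qed.

Lemma tail_sum w t m n : tail_of w t -> (m <= n)%N ->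
  \sum_(m <= k < n) w k = t m - t n.
Proof.
move=> [_ tS _]; elim: n => [|n IH].
  by rewrite leqn0 => /eqP->; rewrite big_geq// subrr.
rewrite leq_eqVlt => /orP[/eqP->|mn]; first by rewrite big_geq// subrr.
by rewrite big_nat_recr//= IH// (tS n); ring.
Qed.

Lemma tail_le w t m n : (forall k, 0 <= w k) -> tail_of w t -> (m <= n)%N ->
  t n <= t m.
Proof.
by move=> w0 tw mn; rewrite -subr_ge0 -(tail_sum tw mn) sumr_ge0.
Qed.

Lemma tail_gt0 w t n : (forall k, 0 < w k) -> tail_of w t -> 0 < t n.
Proof. by move=> w0 [t0 tS _]; rewrite tS ltr_pwDl. Qed.

Lemma tail_leP w t n (D : R) : (forall k, 0 <= w k) -> tail_of w t ->
  (forall N, \sum_(n <= k < N) w k <= D) -> t n <= D.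
Proof.
move=> w0 tw h; apply/ler_addgt0Pr => e e0; have [_ _ /(_ _ e0)[m tm]] := tw.
have [mn|/ltnW nm] := leqP m n.
  have D0 := h 0%N; rewrite big_geq// in D0.
  by rewrite ler_wpDl// (le_trans (tail_le w0 tw mn))// ltW.
by have := h m; rewrite (tail_sum tw nm); lra.
Qed.

End Tails.

(** * Comparing sorted sequences *)

Section Combinatorics.
Variable R : realType.
Implicit Types (p Q C : R) (x y u v t : nat -> R).

Lemma powRrK (a r : R) : 0 <= a -> r != 0 -> (a `^ r^-1) `^ r = a.
Proof. by move=> a0 r0; rewrite -powRrM mulVf// powRr1. Qed.

Lemma powR_sum_le p (a b : R) : 0 <= p -> 0 <= a -> 0 <= b ->
  (a + b) `^ p <= 2 `^ p * (a `^ p + b `^ p).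
Proof.
move=> p0 a0 b0; wlog ab : a b a0 b0 / a <= b.
  move=> H; have [ab|/ltW ba] := leP a b; first exact: H.
  by rewrite addrC (addrC (a `^ p)); exact: H.
apply: (@le_trans _ _ (2 `^ p * b `^ p)); last first.
  by rewrite ler_wpM2l ?powR_ge0// lerDr powR_ge0.
by rewrite -powRM// le_powR ?addr_ge0// mulr_natl mulr2n lerD.
Qed.

(** Either v <= b, or (v / b)^p <= (v / b)^Q; summed over n indices this plays the
    part of Hoelder's inequality between the exponents p and Q. *)
Lemma powR_interp_le p Q (v b : R) : 0 < p -> p < Q -> 0 <= v -> 0 < b ->
  v `^ p <= b `^ p + v `^ Q * b `^ (p - Q).
Proof.
move=> p0 pQ v0 b0; have [vb|bv] := leP v b.
  by rewrite ler_wpDr ?mulr_ge0 ?powR_ge0// le_powR// ltW.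
have vp : 0 < v by exact: lt_trans bv.
rewrite ler_wpDl ?powR_ge0// -(opprB Q p) powRN ler_pdivlMr ?powR_gt0//.
rewrite (_ : v `^ Q = v `^ p * v `^ (Q - p)); last first.
  by rewrite -powRD ?(gt_eqF vp) ?implybT// subrKC.
rewrite ler_pM2l ?powR_gt0//; apply: le_powR.
- by rewrite subr_ge0 ltW.
- exact: ltW.
- exact: ltW.
Qed.

(** The hypothesis is what a K-functional inequality gives. At rank n, the first n
    entries of y are controlled by the p-mean a of the first n entries of x and by
    the quantity b such that n b^Q is the tail mass of x. If b <= a, the p-th
    powers of the head of y are controlled by those of the head of x. Otherwise
    the last entry of the head of y is at most a multiple of b; all later entries
    are smaller, which turns the p-th powers of u into Q-th powers of order b^Q,
    so that the tail of y is controlled by the tail of x. *)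
Lemma head_tail_alternative p Q C x y t : 0 < p -> p < Q -> 0 <= C ->
  (forall k, 0 < x k) -> (forall k, 0 <= y k) ->
  (forall i j, (i <= j)%N -> y j <= y i) ->
  tail_of (fun k => x k `^ Q) t ->
  (forall n, exists u v, [/\ forall k, 0 <= u k, forall k, 0 <= v k,
     forall k, y k <= u k + v k,
     forall N, \sum_(k < N) u k `^ p <= C * \sum_(k < n) x k `^ p
   & forall N, \sum_(k < N) v k `^ Q <= C * t n]) ->
  exists2 D, 0 <= D & forall n,
    \sum_(k < n.+1) y k `^ p <= D * \sum_(k < n.+1) x k `^ p \/
    (y n `^ Q <= D * t n.+1 /\
     forall N, \sum_(n.+1 <= k < N) y k `^ Q <= D * t n.+1).
Proof.
move=> p0 pQ C0 x0 y0 ydec tx H.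
have Q0 : 0 < Q by exact: lt_trans pQ.
pose C1 := 2 `^ p * (1 + 2 * C); pose C3 := C1 `^ p^-1.
pose D2 := 2 `^ Q * C + C3 `^ (Q - p) * (2 `^ p * C).
have C1_ge0 : 0 <= C1 by rewrite mulr_ge0 ?powR_ge0// addr_ge0// mulr_ge0.
have D2_ge0 : 0 <= D2 by rewrite addr_ge0// !mulr_ge0 ?powR_ge0.
have C3Q_ge0 : 0 <= C3 `^ Q by exact: powR_ge0.
have [D [D_ge0 DC1 DC3 DD2]] : exists D, [/\ 0 <= D, C1 <= D, C3 `^ Q <= D & D2 <= D].
  exists (C1 + (C3 `^ Q + D2)); split.
  - by rewrite addr_ge0// addr_ge0.
  - by rewrite lerDl addr_ge0.
  - by rewrite addrCA lerDl addr_ge0.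
  - by rewrite addrA lerDr addr_ge0.
exists D => // n.
have [u [v [u0 v0 yuv uP vP]]] := H n.+1.
set P := \sum_(k < n.+1) x k `^ p in uP *.
have P0 : 0 < P.
  by rewrite /P big_ord_recl ltr_pwDl ?powR_gt0// sumr_ge0// => k _; exact: powR_ge0.
clearbody P.
have t0 : 0 < t n.+1 by apply: tail_gt0 tx => k; exact: powR_gt0.
have [m m0 mE] : exists2 m : R, 0 < m & m = n.+1%:R by exists n.+1%:R.
pose a := (P / m) `^ p^-1; pose b := (t n.+1 / m) `^ Q^-1.
have a0 : 0 < a by rewrite powR_gt0// divr_gt0.
have b0 : 0 < b by rewrite powR_gt0// divr_gt0.
have aE : P = m * a `^ p.
  by rewrite powRrK ?gt_eqF ?divr_ge0 ?(ltW P0) ?(ltW m0)// mulrC divfK// gt_eqF.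
have bE : t n.+1 = m * b `^ Q.
  by rewrite powRrK ?gt_eqF ?divr_ge0 ?(ltW t0) ?(ltW m0)// mulrC divfK// gt_eqF.
clearbody a b.
have head : \sum_(k < n.+1) y k `^ p <=
    2 `^ p * (C * (m * a `^ p) + (m * b `^ p + C * (m * b `^ p))).
  apply: (@le_trans _ _ (\sum_(k < n.+1) 2 `^ p *
     (u k `^ p + (b `^ p + v k `^ Q * b `^ (p - Q))))).
    apply: ler_sum => k _.
    rewrite (le_trans (le_powR (ltW p0) (y0 k) (yuv k)))//.
    rewrite (le_trans (powR_sum_le (ltW p0) (u0 k) (v0 k)))//.
    rewrite ler_wpM2l ?powR_ge0// lerD2l; exact: powR_interp_le.
  rewrite -mulr_sumr !big_split/= ler_wpM2l ?powR_ge0// lerD//.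
    by rewrite -aE; exact: uP.
  rewrite sumr_const card_ord -mulr_natl -mE lerD2l -mulr_suml.
  rewrite (le_trans (ler_wpM2r (powR_ge0 _ _) (vP _)))//.
  rewrite bE -!mulrA -powRD ?(gt_eqF b0) ?implybT// subrKC//.
have [ba|/ltW ab] := leP b a.
  left; rewrite (le_trans head)// aE.
  have := le_powR (ltW p0) (ltW b0) ba => ba'.
  apply: (@le_trans _ _ (C1 * (m * a `^ p))); last first.
    by rewrite ler_wpM2r// mulr_ge0 ?powR_ge0// ltW.
  rewrite /C1 -mulrA ler_wpM2l ?powR_ge0//.
  rewrite [leRHS](_ : _ = C * (m * a `^ p) + (m * a `^ p + C * (m * a `^ p))); last by ring.
  have mba : m * b `^ p <= m * a `^ p by rewrite ler_pM2l.
  rewrite lerD2l; apply: lerD; first exact: mba.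
  apply: ler_wpM2l; [exact: C0|exact: mba].
right.
have ab' := le_powR (ltW p0) (ltW a0) ab.
have mab : m * a `^ p <= m * b `^ p by rewrite ler_pM2l.
have ynp : y n `^ p <= C1 * b `^ p.
  rewrite -(ler_pM2l m0) (le_trans (_ : _ <= \sum_(k < n.+1) y k `^ p))//.
    rewrite [leLHS](_ : _ = \sum_(k < n.+1) y n `^ p); last first.
      by rewrite sumr_const card_ord mE mulr_natl.
    apply: ler_sum => k _; apply: le_powR; rewrite ?ydec ?(ltW p0)//.
    by rewrite -ltnS.
  rewrite (le_trans head)// /C1.
  rewrite [leRHS](_ : _ =
      2 `^ p * (C * (m * b `^ p) + (m * b `^ p + C * (m * b `^ p)))); last by ring.
  apply: ler_wpM2l; first exact: powR_ge0.
  rewrite lerD2r; apply: ler_wpM2l; [exact: C0|exact: mab].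
have yn : y n <= C3 * b.
  rewrite -[y n]powRr1// -(mulfV (lt0r_neq0 p0)) powRrM.
  rewrite (le_trans (le_powR _ (powR_ge0 _ _) ynp)) ?invr_ge0 ?(ltW p0)//.
  by rewrite powRM ?powR_ge0// -powRrM mulfV ?gt_eqF// powRr1// ltW.
have C30 : 0 <= C3 by exact: powR_ge0.
split.
  rewrite (le_trans (le_powR (ltW Q0) (y0 n) yn))// powRM ?(ltW b0)//.
  apply: ler_pM; rewrite ?powR_ge0//.
  by rewrite bE ler_peMl ?powR_ge0// mE ler1n.
move=> N; apply: (@le_trans _ _ (\sum_(k < N)
   (2 `^ Q * v k `^ Q + C3 `^ (Q - p) * (b `^ (Q - p) * (2 `^ p * u k `^ p))))).
  have F0 k : 0 <=
      2 `^ Q * v k `^ Q + C3 `^ (Q - p) * (b `^ (Q - p) * (2 `^ p * u k `^ p)).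
    by rewrite addr_ge0 ?mulr_ge0 ?powR_ge0.
  have [nN|Nn] := leqP n.+1 N; last first.
    by rewrite big_geq ?(ltnW Nn)// sumr_ge0.
  rewrite -(big_mkord xpredT (fun k =>
    2 `^ Q * v k `^ Q + C3 `^ (Q - p) * (b `^ (Q - p) * (2 `^ p * u k `^ p)))).
  rewrite [leRHS](@big_cat_nat _ _ _ n.+1)//= ler_wpDl ?sumr_ge0//.
  rewrite !big_nat; apply: ler_sum => k /andP[nk _].
  have [uv|/ltW vu] := leP (u k) (v k).
    rewrite ler_wpDr ?mulr_ge0 ?powR_ge0// -powRM//; apply: le_powR => //.
      exact: ltW.
    by rewrite (le_trans (yuv k))// mulr_natl mulr2n lerD.
  rewrite ler_wpDl ?mulr_ge0 ?powR_ge0//.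
  have [->|yk0] := eqVneq (y k) 0.
    by rewrite powR0 ?gt_eqF// ?mulr_ge0 ?powR_ge0.
  have -> : y k `^ Q = y k `^ (Q - p) * y k `^ p.
    by rewrite -powRD ?yk0 ?implybT// subrK.
  rewrite mulrA -powRM ?(ltW b0)//; apply: ler_pM; rewrite ?powR_ge0//.
    apply: le_powR => //; first by rewrite subr_ge0 ltW.
    by rewrite (le_trans _ yn)// ydec// ltnW.
  rewrite -powRM//; apply: le_powR => //; first exact: ltW.
  by rewrite (le_trans (yuv k))// mulr_natl mulr2n lerD.
rewrite big_split/= -!mulr_sumr.
apply: (@le_trans _ _ (2 `^ Q * (C * t n.+1) +
   C3 `^ (Q - p) * (b `^ (Q - p) * (2 `^ p * (C * P))))).
  apply: lerD; first by apply: ler_wpM2l; [exact: powR_ge0|exact: vP].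
  do 3 (apply: ler_wpM2l; first exact: powR_ge0).
  exact: uP.
apply: (@le_trans _ _ (D2 * t n.+1)); last first.
  by rewrite ler_wpM2r// ltW.
have bQ : b `^ (Q - p) * a `^ p <= b `^ Q.
  have -> : b `^ Q = b `^ (Q - p) * b `^ p.
    by rewrite -powRD ?(gt_eqF b0) ?implybT// subrK.
  by apply: ler_wpM2l; [exact: powR_ge0|exact: ab'].
rewrite /D2 mulrDl mulrA lerD2l aE bE.
rewrite [leLHS](_ : _ = C3 `^ (Q - p) * (2 `^ p * C) * (m * (b `^ (Q - p) * a `^ p))).
  apply: ler_wpM2l; last by rewrite ler_pM2l.
  by apply: mulr_ge0; [|apply: mulr_ge0] => //; exact: powR_ge0.
by rewrite !mulrA; ring.
Qed.

(** Greedy filling of bins of sizes x i by items y k, in order. An item put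
    into a bin smaller than itself would force the head sum of y to exceed half
    of the one of x. *)
Lemma fill_bins p x y (A : pred nat) : 0 < p ->
  (forall k, 0 < x k) -> (forall i j, (i <= j)%N -> x j <= x i) ->
  (forall k, 0 <= y k) -> (forall i j, (i <= j)%N -> y j <= y i) ->
  (forall k, A k -> 2 * \sum_(l < k.+1) y l `^ p <= \sum_(l < k.+1) x l `^ p) ->
  exists phi : nat -> nat, (forall k, A k -> y k <= x (phi k)) /\
    forall i N, \sum_(k < N | A k && (phi k == i)) y k `^ p <= 2 * x i `^ p.
Proof.
move=> p0 x0 xdec y0 ydec HA.
pose P n := \sum_(l < n) x l `^ p.
pose Y n := \sum_(l < n | A l) y l `^ p.
have Y_le k : Y k <= \sum_(l < k) y l `^ p.
  by rewrite /Y big_mkcond; apply: ler_sum => l _; case: ifP; rewrite ?powR_ge0.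
have Yle n : Y n < P n.+1.
  have P0 k : 0 <= P k by rewrite sumr_ge0// => l _; exact: powR_ge0.
  suff h : Y n <= P n by rewrite (le_lt_trans h)// /P big_ord_recr/= ltrDl powR_gt0.
  elim: n => [|n IH]; first by rewrite /Y /P !big_ord0.
  have [An|nAn] := boolP (A n).
    rewrite (le_trans (Y_le _))// (le_trans _ (HA n An))// ler_peMl ?ler1n//.
    by rewrite sumr_ge0// => l _; exact: powR_ge0.
  rewrite /Y big_mkcond big_ord_recr/= (negbTE nAn) addr0 -big_mkcond.
  by rewrite (le_trans IH)// /P big_ord_recr/= lerDl powR_ge0.
have ex k : exists i, Y k < P i.+1 by exists k.
pose phi k := ex_minn (ex k).
have phi1 k : Y k < P (phi k).+1 by rewrite /phi; case: ex_minnP.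
have phi2 k : P (phi k) <= Y k.
  rewrite /phi; case: ex_minnP => -[_ _|i _ hi].
    by rewrite /P big_ord0 sumr_ge0// => l _; exact: powR_ge0.
  by rewrite leNgt; apply/negP => /hi; rewrite ltnn.
have phi3 k : (phi k <= k)%N by rewrite /phi; case: ex_minnP => i _; apply.
have yx k : A k -> y k <= x (phi k).
  move=> Ak; rewrite leNgt; apply/negP => xy.
  pose Z := \sum_(l < k.+1) y l `^ p.
  have h1 : P (phi k) <= Z.
    rewrite (le_trans (phi2 k))// (le_trans (Y_le k))//.
    by apply: (ge0_sum_ord_le (fun l => powR_ge0 (y l) p)).
  have h2 : k.+1%:R * y k `^ p <= Z.
    rewrite [leLHS](_ : _ = \sum_(l < k.+1) y k `^ p); last first.
      by rewrite sumr_const card_ord mulr_natl.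
    apply: ler_sum => l _; apply: le_powR; rewrite ?ydec ?(ltW p0)//.
    by rewrite -ltnS.
  have := HA k Ak; rewrite -/Z => h3.
  have h4 : P k.+1 < P (phi k) + k.+1%:R * y k `^ p.
    rewrite /P -!(big_mkord xpredT (fun l => x l `^ p)).
    rewrite (@big_cat_nat _ _ _ (phi k))//=; last exact: leq_trans (phi3 k) _.
    rewrite ltrD2l (@le_lt_trans _ _ (\sum_(phi k <= l < k.+1) x (phi k) `^ p))//.
      rewrite !big_nat; apply: ler_sum => l /andP[h _].
      apply: le_powR; rewrite ?xdec ?(ltW p0) ?(ltW (x0 _))//.
    rewrite sumr_const_nat -[ltLHS]mulr_natl.
    apply: (@le_lt_trans _ _ (k.+1%:R * x (phi k) `^ p)).
      by rewrite ler_wpM2r ?powR_ge0// ler_nat leq_subr.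
    rewrite ltr_pM2l//; apply: gt0_ltr_powR => //; rewrite nnegrE ?y0//.
    exact: ltW.
  by rewrite -/(P k.+1) in h3; lra.
exists phi; split => // i N.
pose G n := \sum_(k < n | A k && (phi k == i)) y k `^ p.
have GS n : G n.+1 = G n + (if A n && (phi n == i) then y n `^ p else 0).
  by rewrite /G big_mkcond big_ord_recr/= -big_mkcond.
have YS n : Y n.+1 = Y n + (if A n then y n `^ p else 0).
  by rewrite /Y big_mkcond big_ord_recr/= -big_mkcond.
have PS n : P n.+1 = P n + x n `^ p by rewrite /P big_ord_recr.
(* The bin i starts to be filled when the items put so far reach P i; before its
   last item it is not full, and that item is not larger than the bin. *)
have G1 n : G n <= Num.max 0 (Y n - P i).
  elim: n => [|n IH]; first by rewrite /G big_ord0 le_max lexx.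
  rewrite GS YS; case: (boolP (A n)) => [An|_] /=; last by rewrite !addr0.
  case: eqVneq => [phin|_].
    have h : 0 <= Y n - P i by rewrite subr_ge0 -phin phi2.
    rewrite le_max; apply/orP; right; move: IH; rewrite (max_r h); lra.
  rewrite addr0 (le_trans IH)// le_max2// addrAC lerDl; exact: powR_ge0.
suff : G N <= 2 * x i `^ p by [].
elim: N => [|n IH]; first by rewrite /G big_ord0 mulr_ge0 ?powR_ge0.
rewrite GS; case: ifPn => [/andP[An /eqP phin]|_]; last by rewrite addr0.
have h1 := phi1 n; rewrite phin PS in h1.
have h2 := G1 n; rewrite max_r in h2; last by rewrite subr_ge0 -phin phi2.
have h3 : y n `^ p <= x i `^ p by apply: le_powR; rewrite ?(ltW p0)// -phin yx.
by lra.
Qed.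

(** The tail masses of x and of y cut the indices of x into consecutive blocks,
    one for each k, placed after k; the tail mass of y is first perturbed by x,
    so that it is positive and all blocks are finite. *)
Lemma tail_blocks Q x y t : 0 < Q ->
  (forall k, 0 < x k) -> (forall i j, (i <= j)%N -> x j <= x i) ->
  (forall k, 0 <= y k) -> tail_of (fun k => x k `^ Q) t ->
  (forall n N, 4 * \sum_(n <= k < N) y k `^ Q <= t n) ->
  exists2 g : nat -> nat, (forall i j, (i <= j)%N -> (g i <= g j)%N) &
    forall k, 2 * x k `^ Q < y k `^ Q ->
      y k `^ Q <= 2 * \sum_(g k <= i < g k.+1) x i `^ Q.
Proof.
move=> Q0 x0 xdec y0 tx H.
have [t_ge0 tS tlim] := tx.
(* The perturbation: w is positive and its tails are still at most half of those
   of x. *)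
pose w k := y k `^ Q + x k `^ Q / 4.
have w_gt0 k : 0 < w k by rewrite ltr_wpDl ?powR_ge0// divr_gt0 ?powR_gt0.
have w_sum n N : 2 * \sum_(n <= k < N) w k <= t n.
  rewrite big_split/= -mulr_suml mulrDr.
  have [nN|Nn] := leqP n N; last first.
    by rewrite !big_geq ?(ltnW Nn)// mul0r mulr0 addr0.
  rewrite (tail_sum tx nN); have := H n N; have := t_ge0 N; lra.
have [s ts] : exists s, tail_of w s.
  apply: (@exists_tail _ w (t 0%N)) => [k|N]; first exact: ltW.
  have := w_sum 0%N N; rewrite big_mkord.
  have : 0 <= \sum_(k < N) w k by rewrite sumr_ge0// => k _; exact: ltW.
  lra.
have s_gt0 n : 0 < s n by exact: tail_gt0 ts.
have st n : s n < t n.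
  have h : s n <= t n / 2.
    by apply: (tail_leP _ ts) => [k|N]; [exact: ltW|have := w_sum n N; lra].
  by have := s_gt0 n; lra.
have xQ_ge0 k : 0 <= x k `^ Q by exact: powR_ge0.
have ex k : exists i, t i <= s k.
  by have [n tn] := tlim _ (s_gt0 k); exists n; exact: ltW.
pose g k := ex_minn (ex k).
have g1 k : t (g k) <= s k by rewrite /g; case: ex_minnP.
have g2 k i : t i <= s k -> (g k <= i)%N.
  by rewrite /g; case: ex_minnP => m _ + h; apply.
have gk k : (k < g k)%N.
  rewrite ltnNge; apply/negP => gk.
  have := tail_le xQ_ge0 tx gk; rewrite leNgt => /negP; apply.
  exact: le_lt_trans (g1 k) (st k).
exists g => [i j ij|k hk].
  apply: g2; rewrite (le_trans (g1 j))//.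
  by apply: (tail_le _ ts) => // k; exact: ltW.
have gS : (g k <= g k.+1)%N.
  by apply: g2; rewrite (le_trans (g1 _))// (tail_le _ ts)// => i; exact: ltW.
rewrite (tail_sum tx gS).
have gpos : (0 < g k)%N by exact: leq_ltn_trans (gk k).
(* The block of k misses the mass w k by at most the entry of x just before it,
   which is at most x k, hence negligible with respect to y k. *)
have h1 : s k < t (g k).-1.
  by rewrite ltNge; apply/negP => /g2; rewrite leqNgt prednK// leqnn.
have h2 := tS (g k).-1; rewrite prednK// in h2.
have h3 : x (g k).-1 `^ Q <= x k `^ Q.
  by apply: le_powR; rewrite ?xdec ?(ltW Q0) ?(ltW (x0 _))// -ltnS prednK.
have h4 := g1 k.+1; have [_ /(_ k) h5 _] := ts.
have : 0 <= x k `^ Q / 4 by rewrite divr_ge0.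
by move: h5; rewrite /w; lra.
Qed.

End Combinatorics.

(** * Weighted composition operators and block operators *)

Section Operators.
Variable R : realType.
Implicit Types (z : R^nat) (c : nat -> R) (h g : nat -> nat).

Definition wcomp c h z : R^nat := fun n => c n * z (h n).

Lemma seq_linE (a : R) (x y : R^nat) k : (a *: x + y) k = a * x k + y k.
Proof. by []. Qed.

Lemma wcomp_linear p c h : linear_map_on (lp p) (wcomp c h).
Proof.
by move=> a x y _ _; apply/funext => n; rewrite seq_linE /wcomp seq_linE; ring.
Qed.

(** Sorting the indices n by the value h n, the entry z i is used with total
    weight at most B. *)
Lemma lpsum_le_wcomp (p B M : R) c h z : 0 <= p ->
  (forall i N, \sum_(n < N | h n == i) lpterm p (c n) <= B) ->
  lpsum_le p z M -> lpsum_le p (wcomp c h z) (B * M).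
Proof.
move=> p0 cB zM N; have B0 : 0 <= B by have := cB 0%N 0%N; rewrite big_ord0.
pose m := (\max_(n < N) (h n).+1)%N.
have hm (n : 'I_N) : (h n < m)%N by exact: (leq_bigmax n).
apply: (@le_trans _ _ (\sum_(i < m) B * lpterm p (z i))); last first.
  by rewrite -mulr_sumr ler_wpM2l.
apply: (@le_trans _ _ (\sum_(n < N) lpterm p (c n) * lpterm p (z (h n)))).
  apply: ler_sum => n _; rewrite /wcomp.
  have [->|c0] := eqVneq (c n) 0; first by rewrite mul0r !lpterm0 mul0r.
  by rewrite (lpterm_neq0 _ c0); exact: lptermM.
rewrite (partition_big (fun n : 'I_N => Ordinal (hm n)) xpredT)//=.
apply: ler_sum => i _; rewrite (eq_bigr (fun n : 'I_N => lpterm p (c n) * lpterm p (z i))).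
  rewrite -mulr_suml ler_wpM2r ?lpterm_ge0//; exact: cB.
by move=> n /eqP <-.
Qed.

Lemma sum_le_one_nonzero (N : nat) (P : pred 'I_N) (F : 'I_N -> R) (B : R) :
  0 <= B -> (forall n, F n <= B) ->
  (forall m n, P m -> P n -> F m != 0 -> F n != 0 -> m = n) ->
  \sum_(n < N | P n) F n <= B.
Proof.
move=> B0 FB inj; have [/existsP[m /andP[Pm Fm]]|/existsPn nF] :=
  boolP [exists n, P n && (F n != 0)].
  rewrite (bigD1 m)//= big1 ?addr0// => n /andP[Pn nm].
  by apply/eqP/negPn/negP => Fn; rewrite (inj n m)// eqxx in nm.
rewrite big1// => n Pn; apply/eqP; have := nF n; by rewrite Pn /= negbK.
Qed.

Lemma lpball_wcomp_inj (p : \bar R) (b : R) c h : (0 <= p)%E ->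
  (forall n, `|c n| <= b) ->
  (forall m n, c m != 0 -> c n != 0 -> h m = h n -> m = n) ->
  exists2 B, 0 <= B & forall z M, lpball p z M -> lpball p (wcomp c h z) (B * M).
Proof.
move=> p0 cb hinj; have b0 : 0 <= b by exact: le_trans (normr_ge0 _) (cb 0%N).
case: p p0 => [p||]//= p0; last first.
  exists b => // z' M' zM n; rewrite normrM ler_pM//.
exists (b `^ p); first exact: powR_ge0.
rewrite lee_fin in p0; move=> z' M'; apply: lpsum_le_wcomp => // i N.
apply: sum_le_one_nonzero => [||m n /eqP hm /eqP hn cm cn].
- exact: powR_ge0.
- move=> n; have [->|c0] := eqVneq (c n) 0; first by rewrite lpterm0 powR_ge0.
  by rewrite lpterm_neq0// le_powR.
- apply/val_inj/hinj; rewrite ?hm ?hn//.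
    by apply: contraNneq cm => ->; rewrite lpterm0.
  by apply: contraNneq cn => ->; rewrite lpterm0.
Qed.

Lemma bounded_wcomp_inj (p : \bar R) (b : R) c h : (0 <= p)%E ->
  (forall n, `|c n| <= b) ->
  (forall m n, c m != 0 -> c n != 0 -> h m = h n -> m = n) ->
  bounded_map (lp p) (wcomp c h).
Proof.
move=> p0 cb hinj; apply/(bounded_lpP p0); last exact: (@lpball_wcomp_inj _ b c h).
by apply/funext => n; rewrite /wcomp mulr0.
Qed.

Lemma bounded_operators_wcomp_inj (p q : \bar R) (b : R) c h :
  (0 <= p)%E -> (0 <= q)%E -> (forall n, `|c n| <= b) ->
  (forall m n, c m != 0 -> c n != 0 -> h m = h n -> m = n) ->
  bounded_operators p q (wcomp c h).
Proof.
move=> p0 q0 cb hinj; split; first exact: wcomp_linear.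
- exact: (bounded_wcomp_inj q0 cb).
- exact: (bounded_wcomp_inj p0 cb).
Qed.

(** The p-th powers of the weights collected by each source index i are bounded by
    B; since weights are at most 1, so are the powers with larger exponents. *)
Lemma bounded_operators_wcomp_fill (p : R) (r : \bar R) (B : R) c h :
  0 < p -> (p%:E <= r)%E -> 0 <= B ->
  (forall n, 0 <= c n <= 1) ->
  (forall i N, \sum_(n < N | h n == i) c n `^ p <= B) ->
  bounded_operators p%:E r (wcomp c h).
Proof.
move=> p0 pr B0 c01 cB; have r0 : (0 <= r)%E by rewrite (le_trans _ pr)// lee_fin ltW.
have W0 : wcomp c h 0 = 0 by apply/funext => n; rewrite /wcomp mulr0.
have cn n : `|c n| = c n by have /andP[/ger0_norm] := c01 n.
have fin (a : R) : p <= a -> bounded_map (lp a%:E) (wcomp c h).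
  move=> pa; have a0 : 0 < a by exact: lt_le_trans pa.
  apply/bounded_lpP => //; first by rewrite lee_fin ltW.
  exists B => // z M; apply: lpsum_le_wcomp; first exact: ltW.
  move=> i N; apply: le_trans (cB i N); apply: ler_sum => n _.
  rewrite lpterm_pos ?gt_eqF// cn; have /andP[] := c01 n.
  rewrite le_eqVlt => /orP[/eqP<- _|c0 c1].
    by rewrite !powR0// gt_eqF.
  by rewrite ger_powR// c0.
split; [exact: wcomp_linear| |exact: fin].
case: r pr r0 => [a||]// pa r0; first exact: fin.
apply/bounded_lpP => //; exists 1 => // z M zM n.
rewrite /wcomp normrM ler_pM// cn; by have /andP[] := c01 n.
Qed.

Definition block_op (wt c : nat -> R) g z : R^nat :=
  fun k => c k * \sum_(g k <= i < g k.+1) wt i * z i.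

Lemma block_op_linear p wt c g : linear_map_on (lp p) (block_op wt c g).
Proof.
move=> a x y _ _; apply/funext => n; rewrite seq_linE /block_op mulrCA -mulrDr.
congr (_ * _); rewrite mulr_sumr -big_split/=; apply: eq_bigr => i _.
by rewrite seq_linE; ring.
Qed.

(** The blocks are disjoint. *)
Lemma lpsum_le_blocks (p B M : R) g z z' : 0 <= B ->
  (forall i j, (i <= j)%N -> (g i <= g j)%N) ->
  (forall k, lpterm p (z' k) <= B * \sum_(g k <= i < g k.+1) lpterm p (z i)) ->
  lpsum_le p z M -> lpsum_le p z' (B * M).
Proof.
move=> B0 gm zz' zM N; apply: (@le_trans _ _ (B * \sum_(0 <= i < g N) lpterm p (z i))).
  apply: (@le_trans _ _ (B * \sum_(g 0%N <= i < g N) lpterm p (z i))); last first.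
    rewrite ler_wpM2l// [leRHS](@big_cat_nat _ _ _ (g 0%N))//= ?gm// lerDr.
    by rewrite sumr_ge0// => i _; exact: lpterm_ge0.
  elim: N => [|N IH]; first by rewrite big_ord0 big_geq// mulr0.
  rewrite big_ord_recr/= (@big_cat_nat _ _ _ (g N))/= ?gm// mulrDr lerD//.
by rewrite ler_wpM2l// big_mkord.
Qed.

(** The inclusion of l^q in l^Q, on a finite interval of indices. *)
Lemma powR_sum_sub (q Q : R) (a : nat -> R) m n : 0 < q -> q <= Q ->
  (forall i, 0 <= a i) ->
  (\sum_(m <= i < n) a i `^ Q) `^ (q / Q) <= \sum_(m <= i < n) a i `^ q.
Proof.
move=> q0 qQ a0; have Q0 : 0 < Q by exact: lt_le_trans qQ.
set S := \sum_(m <= i < n) a i `^ q.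
have S0 : 0 <= S by rewrite sumr_ge0// => i _; exact: powR_ge0.
have aS i : (m <= i < n)%N -> a i <= S `^ q^-1.
  move=> /andP[mi ni]; rewrite -[a i]powRr1// -(mulfV (lt0r_neq0 q0)) powRrM.
  apply: le_powR; rewrite ?powR_ge0 ?invr_ge0 ?(ltW q0)//.
  rewrite /S (@big_cat_nat _ _ _ i)//= ?(ltnW ni)// [X in _ + X]big_ltn//.
  rewrite addrCA lerDl addr_ge0// sumr_ge0// => j _; exact: powR_ge0.
have h : \sum_(m <= i < n) a i `^ Q <= S `^ (Q / q).
  apply: (@le_trans _ _ (\sum_(m <= i < n) a i `^ q * S `^ ((Q - q) / q))).
    rewrite !big_nat; apply: ler_sum => i /aS ai.
    have [->|ai0] := eqVneq (a i) 0.
      by rewrite !powR0 ?gt_eqF// mul0r.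
    have -> : a i `^ Q = a i `^ q * a i `^ (Q - q).
      by rewrite -powRD ?ai0 ?implybT// subrKC.
    rewrite ler_wpM2l ?powR_ge0// [_ / q]mulrC powRrM.
    by apply: le_powR => //; rewrite subr_ge0.
  rewrite -mulr_suml -/S; have [->|Sn0] := eqVneq S 0.
    by rewrite mul0r powR_ge0.
  rewrite -{1}(powRr1 S0) -powRD ?Sn0 ?implybT// le_eqVlt; apply/orP; left.
  by apply/eqP; congr (_ `^ _); field; rewrite gt_eqF.
rewrite (le_trans (le_powR _ _ h))//.
- by rewrite divr_ge0 ?(ltW q0)// ltW.
- by rewrite sumr_ge0// => i _; exact: powR_ge0.
rewrite -powRrM (_ : Q / q * (q / Q) = 1) ?powRr1//.
by field; rewrite !gt_eqF.
Qed.

(** Hoelder's inequality up to a factor 2, for weights x^(Q-1). *)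
Lemma weighted_mean_le (Q : R) (x z : nat -> R) m n : 1 <= Q ->
  (forall i, 0 < x i) -> 0 < \sum_(m <= i < n) x i `^ Q ->
  \sum_(m <= i < n) x i `^ (Q - 1) * `|z i| <=
  2 * (\sum_(m <= i < n) x i `^ Q) *
    ((\sum_(m <= i < n) `|z i| `^ Q) / \sum_(m <= i < n) x i `^ Q) `^ Q^-1.
Proof.
move=> Q1 x0; set S := \sum_(m <= i < n) x i `^ Q => S0.
have Q0 : 0 < Q by exact: lt_le_trans Q1.
set Z := \sum_(m <= i < n) `|z i| `^ Q.
have Z0 : 0 <= Z by rewrite sumr_ge0// => i _; exact: powR_ge0.
have zZ i : (m <= i < n)%N -> `|z i| `^ Q <= Z.
  move=> /andP[mi ni]; rewrite /Z (@big_cat_nat _ _ _ i)//= ?(ltnW ni)//.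
  rewrite [X in _ + X]big_ltn//.
  rewrite addrCA lerDl addr_ge0// sumr_ge0// => j _; exact: powR_ge0.
have [Z00|Zn0] := eqVneq Z 0.
  rewrite big_nat big1 ?mulr_ge0 ?powR_ge0 ?(ltW S0)// => i /zZ.
  rewrite Z00 => h; have /eqP : `|z i| `^ Q = 0 by apply/eqP; rewrite eq_le h powR_ge0.
  by rewrite powR_eq0 => /andP[/eqP-> _]; rewrite mulr0.
have Zp : 0 < Z by rewrite lt_neqAle eq_sym Zn0.
set l := (Z / S) `^ Q^-1; have l0 : 0 < l by rewrite powR_gt0 ?divr_gt0.
(* Compare b with l a; l makes the two terms of the sum equal. *)
have young (a b : R) : 0 < a -> 0 <= b ->
    a `^ (Q - 1) * b <= l * a `^ Q + l * (S / Z) * b `^ Q.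
  move=> a0 b0; have lQ : S / Z = l `^ (- Q).
    rewrite powRN /l powRrK ?gt_eqF ?divr_ge0 ?(ltW S0)//.
    by rewrite invf_div.
  have [bl|lb] := leP b (l * a).
    apply: ler_wpDr.
      by rewrite !mulr_ge0 ?powR_ge0 ?invr_ge0 ?(ltW l0) ?(ltW S0).
    rewrite -(mulr_powRB1 (ltW a0) Q0) [leRHS](_ : _ = a `^ (Q - 1) * (l * a)).
      by apply: ler_wpM2l => //; exact: powR_ge0.
    by ring.
  have bp : 0 < b by rewrite (lt_trans _ lb)// mulr_gt0.
  rewrite ler_wpDl ?mulr_ge0 ?powR_ge0 ?(ltW l0)//.
  rewrite -(mulr_powRB1 b0 Q0) [leRHS]mulrCA [leLHS]mulrC ler_pM2l//.
  rewrite lQ -[X in X * _ * _](powRr1 (ltW l0)) -powRD ?(gt_eqF l0) ?implybT//.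
  rewrite (_ : 1 - Q = - (Q - 1)); last by ring.
   have lp : 0 < l `^ (Q - 1) by exact: powR_gt0.
  rewrite powRN mulrC ler_pdivlMr// mulrC -powRM ?(ltW l0) ?(ltW a0)//.
  apply: le_powR; [by rewrite subr_ge0| |exact: ltW].
  by apply: mulr_ge0; exact: ltW.
apply: (@le_trans _ _ (\sum_(m <= i < n) (l * x i `^ Q + l * (S / Z) * `|z i| `^ Q))).
  by apply: ler_sum => i _; exact: young.
rewrite big_split/= -!mulr_sumr -/S -/Z le_eqVlt; apply/orP; left; apply/eqP.
by rewrite -!mulrA mulVf ?gt_eqF// mulr1; ring.
Qed.

(** On l^0 this holds because the blocks are disjoint. On l^q, Hoelder's
    inequality bounds the k-th entry of the image of z by a multiple of the
    l^Q size of z on the k-th block: here y k is at most a multiple of the l^Q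
    size of x on this block. That size is at most the one in l^q. *)
Lemma bounded_block_op (q : R) (x y : nat -> R) (A : pred nat) g :
  0 < q -> (forall i, 0 < x i) -> (forall i, 0 <= y i) ->
  (forall i j, (i <= j)%N -> (g i <= g j)%N) ->
  let Q := Num.max q 1 in
  let S k := \sum_(g k <= i < g k.+1) x i `^ Q in
  (forall k, A k -> 0 < S k /\ y k `^ Q <= 2 * S k) ->
  bounded_operators 0%E q%:E
    (block_op (fun i => x i `^ (Q - 1)) (fun k => if A k then y k / S k else 0) g).
Proof.
move=> q0 x0 y0 gm Q S HA; set U := block_op _ _ g.
have Q1 : 1 <= Q by rewrite le_max lexx orbT.
have qQ : q <= Q by rewrite le_max lexx.
have Q0 : 0 < Q by exact: lt_le_trans Q1.
have U0 : U 0 = 0.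
  by apply/funext => k; rewrite /U /block_op big1 ?mulr0// => i _; rewrite mulr0.
have UnA z k : ~~ A k -> U z k = 0.
  by move=> /negbTE Ak; rewrite /U /block_op Ak mul0r.
have s0 (p : R) z k : 0 <= \sum_(g k <= i < g k.+1) lpterm p (z i).
  by rewrite sumr_ge0// => i _; exact: lpterm_ge0.
split; first exact: block_op_linear.
- apply/bounded_lpP => //; first by rewrite lee_fin ltW.
  pose B : R := (2 * 2 `^ Q^-1) `^ q; have B0 : 0 <= B by exact: powR_ge0.
  exists B => // z M; apply: (@lpsum_le_blocks _ _ _ g z (U z)) => // k.
  have [Ak|/UnA->] := boolP (A k); last by rewrite lpterm0 mulr_ge0.
  have [Sk yk] := HA k Ak.
  rewrite lpterm_pos ?gt_eqF//.
  under eq_bigr do rewrite lpterm_pos ?gt_eqF//.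
  apply: le_trans (ler_wpM2l B0 (powR_sum_sub _ _ q0 qQ (fun i => normr_ge0 (z i)))).
  rewrite [q / Q]mulrC powRrM /B -powRM; [|exact: mulr_ge0 (powR_ge0 _ _)|exact: powR_ge0].
  apply: le_powR; [exact: ltW|exact: normr_ge0|].
  rewrite /U /block_op Ak normrM ger0_norm; last by rewrite divr_ge0// ltW.
  rewrite (le_trans (ler_wpM2l _ (ler_norm_sum _ _ _)))//.
    by rewrite divr_ge0// ltW.
  under eq_bigr do rewrite normrM ger0_norm ?powR_ge0//.
  rewrite (le_trans (ler_wpM2l _ (weighted_mean_le z Q1 x0 Sk)))//.
    by rewrite divr_ge0// ltW.
  rewrite -/(S k); set Z := \sum_(_ <= _ < _) _.
  have Z0 : 0 <= Z by rewrite sumr_ge0// => i _; exact: powR_ge0.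
  rewrite [leLHS](_ : _ = 2 * (y k * (Z / S k) `^ Q^-1)); last first.
    by field; rewrite gt_eqF.
  rewrite -mulrA ler_wpM2l// -powRM//.
  have -> : y k = (y k `^ Q) `^ Q^-1 by rewrite -powRrM mulfV ?gt_eqF// powRr1.
  rewrite -powRM ?powR_ge0//; last by rewrite divr_ge0// ltW.
  apply: le_powR; rewrite ?invr_ge0 ?(ltW Q0)//.
    by rewrite mulr_ge0 ?powR_ge0 ?divr_ge0// ltW.
  rewrite mulrA ler_pdivrMr// [leRHS]mulrAC; exact: ler_wpM2r.
- apply/bounded_lpP => //; exists 1 => // z M; apply: (@lpsum_le_blocks _ _ _ g z (U z)) => // k.
  rewrite mul1r; have [->|Uk] := eqVneq (U z k) 0; first by rewrite lpterm0.
  rewrite lpterm_neq0// powRr0.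
  have [i /andP[gi ig] zi] : exists2 i, (g k <= i < g k.+1)%N & z i != 0.
    apply: contrapT => h; move/eqP: Uk; apply; rewrite /U /block_op big_nat big1 ?mulr0//.
    move=> i gi; have [->|zi] := eqVneq (z i) 0; first by rewrite mulr0.
    by case: h; exists i.
  rewrite (@big_cat_nat _ _ _ i)//= ?(ltnW ig)// [X in _ + X]big_ltn//.
  rewrite lpterm_neq0// powRr0 addrCA lerDl addr_ge0// sumr_ge0// => j _.
    exact: lpterm_ge0.
  exact: lpterm_ge0.
Qed.

End Operators.

(** * The orbit of a decreasing sequence *)

Section Assembly.
Variable R : realType.
Implicit Types (z : R^nat) (T : R^nat -> R^nat) (E : seq_space R).

Lemma lpterm1 (v : R) : lpterm 1 v = `|v|.
Proof. by rewrite lpterm_pos ?oner_eq0// powRr1. Qed.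

(** For q < 1 an operator bounded on l^q is bounded for the l^1 norm, since its
    values on unit vectors are bounded in l^q, hence in l^1. *)
Lemma bounded_lp_max1 (q : R) T : 0 < q ->
  linear_map_on (lp q%:E) T -> bounded_map (lp q%:E) T ->
  exists2 C, 0 <= C & forall z B, carrier (lp q%:E) z ->
    lpsum_le (Num.max q 1) z B -> lpsum_le (Num.max q 1) (T z) (C * B).
Proof.
move=> q0 Tlin Tb; have q0' : (0 <= q%:E)%E by rewrite lee_fin ltW.
have T0 := linear_map_on0 q0' Tlin.
have [C C0 TC] := (bounded_lpP q0' T0).1 Tb.
have [q1|q1] := leP 1 q; first by exists C => // z B _; exact: TC.
pose e i : R^nat := fun k => (k == i)%:R.
have he i : lpball q%:E (e i) 1.
  move=> N; apply: sum_le_one_nonzero => // [n|m n _ _].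
    rewrite /e; case: (_ == _); last by rewrite lpterm0.
    by rewrite lpterm_neq0 ?oner_eq0// normr1 powR1.
  rewrite /e; case: (eqVneq (m : nat) i) => [mi _|_]; last by rewrite lpterm0 eqxx.
  case: (eqVneq (n : nat) i) => [ni _|_]; last by rewrite lpterm0 eqxx.
  by apply: val_inj; rewrite /= mi ni.
have qE1 : (q%:E <= 1%:E)%E by rewrite lee_fin ltW.
pose C1 := C `^ q^-1; have C10 : 0 <= C1 by exact: powR_ge0.
have Te i : lpsum_le 1 (T (e i)) C1.
  have [B' hB' BE] := lpball_sub q0 qE1 (TC _ _ (he i)).
  have B'0 := lpball_ge0 hB'.
  have -> : C1 = B'; last exact: hB'.
  move: BE; rewrite /= /fin_lproot oner_eq0 gt_eqF// invr1 powRr1// => ->.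
  by rewrite mulr1.
have trE n z : trunc n.+1 z = z n *: e n + trunc n z.
  apply/funext => k; rewrite seq_linE /e /trunc ltnS leq_eqVlt.
  case: eqVneq => [->|kn] /=; first by rewrite ltnn mulr1 addr0.
  by rewrite mulr0 add0r.
have ec i : carrier (lp q%:E) (e i) by apply/(carrier_lpP _ q0'); exists 1.
have Ttr n z : lpsum_le 1 (T (trunc n z)) (C1 * \sum_(i < n) `|z i|).
  elim: n => [|n IH] N.
    rewrite big_ord0 mulr0 (_ : trunc 0 z = 0) ?T0; last first.
      by apply/funext => k; rewrite /trunc ltn0.
    by rewrite big1// => k _; exact: lpterm0.
  rewrite trE Tlin//; last exact: carrier_trunc.
  rewrite big_ord_recr/= mulrDr [leRHS]addrC.
  apply: (@le_trans _ _ (\sum_(k < N) (`|z n| * lpterm 1 (T (e n) k) + lpterm 1 (T (trunc n z) k)))).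
    apply: ler_sum => k _; rewrite seq_linE !lpterm1.
    by rewrite (le_trans (ler_normD _ _))// normrM.
  rewrite big_split/= -mulr_sumr; apply: lerD; last exact: IH.
  by rewrite mulrC; apply: ler_wpM2r => //; exact: Te.
exists (2 `^ 1 * C1); first by rewrite mulr_ge0// powR_ge0.
move=> z B qz zB; rewrite -mulrA.
apply: (lpsum_le_trunc q0 (lexx _) Tlin Tb qz) => // n N.
rewrite (le_trans (Ttr n z N))//; apply: ler_wpM2l => //.
by apply: le_trans (zB n); apply: ler_sum => i _; rewrite lpterm1.
Qed.

Lemma lpsum_le_vanish (q B : R) z : 0 < q -> lpsum_le q z B ->
  forall e : R, 0 < e -> exists n, forall k, (n <= k)%N -> `|z k| < e.
Proof.
move=> q0 zB e e0; have e2 : 0 < (e / 2) `^ q by rewrite powR_gt0// divr_gt0.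
have [n hn] := lpsum_tail e2 zB; exists n => k nk.
have := @lpball_coord _ q%:E _ _ k _ (hn n (leqnn n)); rewrite lte_fin => /(_ q0).
rewrite /= /fin_lproot gt_eqF// -powRrM mulfV ?gt_eqF// powRr1 ?divr_ge0 ?(ltW e0)//.
rewrite /trunc !fctE ltnNge nk subr0 => /le_lt_trans; apply.
by rewrite ltr_pdivrMr// mulr_natr mulr2n ltrDl.
Qed.

(** The set-theoretic half of the interpolation property; the closed graph theorem
    recovers the other half. *)
Definition op_invariant E (p q : \bar R) : Prop :=
  forall T, bounded_operators p q T -> forall x, carrier E x -> carrier E (T x).

(** Multiplication by a bounded sequence is bounded on all the spaces. *)
Lemma solid E (p q : \bar R) (b : R) x y : (0 <= p)%E -> (0 <= q)%E ->
  op_invariant E p q -> carrier E x -> (forall k, `|y k| <= b * `|x k|) ->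
  carrier E y.
Proof.
move=> p0 q0 Einv Ex yx.
have -> : y = wcomp (fun k => y k / x k) id x.
  apply/funext => k; rewrite /wcomp; have [xk|xk] := eqVneq (x k) 0.
    apply/eqP; rewrite xk mulr0 -normr_le0 (le_trans (yx k))//.
    by rewrite xk normr0 mulr0.
  by rewrite divfK.
apply: Einv => //; apply: (@bounded_operators_wcomp_inj _ _ _ `|b|) => //.
move=> k; have [->|xk] := eqVneq (x k) 0; first by rewrite invr0 mulr0 normr0.
rewrite normrM normfV ler_pdivrMr ?normr_gt0// (le_trans (yx k))//.
by apply: ler_wpM2r => //; exact: ler_norm.
Qed.

(** After scaling, y is the sum of three images of x. Where the head of y is
    controlled by the head of x, filling bins gives a weighted composition
    operator, bounded on l^p and on l^oo. Elsewhere the tail of y is controlled by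
    the tail of x; the entries much larger than those of x are then reached by a
    block operator, bounded on l^0 and on l^q, and the other ones by a
    multiplication. *)
Lemma sorted_transfer E (p q C : R) (s r : \bar R) (x y t : nat -> R) :
  (0 <= s)%E -> (s < p%:E)%E -> 0 < p -> p < q -> (q%:E < r)%E -> 0 <= C ->
  is_quasi_banach E -> op_invariant E s q%:E -> op_invariant E p%:E r ->
  let Q := Num.max q 1 in
  (forall k, 0 < x k) -> (forall i j, (i <= j)%N -> x j <= x i) ->
  (forall k, 0 <= y k) -> (forall i j, (i <= j)%N -> y j <= y i) ->
  tail_of (fun k => x k `^ Q) t ->
  (forall n, exists u v, [/\ forall k, 0 <= u k, forall k, 0 <= v k,
     forall k, y k <= u k + v k,
     forall N, \sum_(k < N) u k `^ p <= C * \sum_(k < n) x k `^ p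
   & forall N, \sum_(k < N) v k `^ Q <= C * t n]) ->
  carrier E x -> carrier E y.
Proof.
move=> s0 sp p0 pq qr C0 qbE Esq Epr Q x0 xdec y0 ydec tx H Ex.
have q0 : 0 < q by exact: lt_trans pq.
have Q1 : 1 <= Q by rewrite le_max lexx orbT.
have Q0 : 0 < Q by exact: lt_le_trans Q1.
have pQ : p < Q by rewrite (lt_le_trans pq)// le_max lexx.
have p0' : (0 <= p%:E)%E by rewrite lee_fin ltW.
have pr : (p%:E < r)%E by rewrite (lt_trans _ qr)// lte_fin.
have r0 : (0 <= r)%E by rewrite (le_trans p0')// ltW.
have [D D0 HD] := head_tail_alternative p0 pQ C0 x0 y0 ydec tx H.
(* Dividing by l turns the factor D into 1/2 for the heads and, the bound on yR
   below being 2 D, into 1/4 for the tails. *)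
pose l := 1 + (2 * D) `^ p^-1 + (8 * D) `^ Q^-1.
have l0 : 0 < l by rewrite /l -addrA ltr_wpDr// addr_ge0// powR_ge0.
have lp : 2 * D <= l `^ p.
  rewrite -[leLHS](@powRrK _ _ p) ?gt_eqF ?mulr_ge0//.
  apply: le_powR; [exact: ltW|exact: powR_ge0|].
  by rewrite /l addrAC lerDr addr_ge0// powR_ge0.
have lQ : 8 * D <= l `^ Q.
  rewrite -[leLHS](@powRrK _ _ Q) ?gt_eqF ?mulr_ge0//.
  apply: le_powR; [exact: ltW|exact: powR_ge0|].
  by rewrite /l lerDr addr_ge0// powR_ge0.
have lp0 : 0 < l `^ p by exact: powR_gt0.
have lQ0 : 0 < l `^ Q by exact: powR_gt0.
pose y1 k := y k / l.
have y1p k (a : R) : y1 k `^ a = y k `^ a / l `^ a.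
  by rewrite /y1 powRVM ?(ltW l0)// powRN.
have y1_ge0 k : 0 <= y1 k by rewrite divr_ge0// ltW.
pose A k := `[< \sum_(l < k.+1) y l `^ p <= D * \sum_(l < k.+1) x l `^ p >].
have xp0 n : 0 <= \sum_(l < n) x l `^ p.
  by rewrite sumr_ge0// => k _; exact: powR_ge0.
have [phi [phi1 phi2]] : exists phi : nat -> nat,
    (forall k, A k -> y1 k <= x (phi k)) /\
    forall i N, \sum_(k < N | A k && (phi k == i)) y1 k `^ p <= 2 * x i `^ p.
  apply: fill_bins => // [i j ij|k /asboolP Ak].
    by apply: ler_wpM2r; [rewrite invr_ge0 ltW|exact: ydec].
  under eq_bigr do rewrite y1p.
  rewrite -mulr_suml mulrA ler_pdivrMr//.
  apply: (@le_trans _ _ (2 * D * \sum_(l < k.+1) x l `^ p)).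
    by rewrite -mulrA ler_pM2l.
  by rewrite mulrC; apply: ler_wpM2l.
have t_ge0 n : 0 <= t n by case: tx.
have tS n : t n.+1 <= t n.
  by apply: (tail_le _ tx) => // k; exact: powR_ge0.
pose yR k := if A k then 0 else y1 k.
(* From the first index where the tail alternative holds on, both that entry and
   the later ones are controlled by the tail of x. *)
have yR_tail n m : \sum_(n <= k < n + m) (if A k then 0 else y k `^ Q) <= 2 * D * t n.
  elim: m n => [|m IH] n.
    by rewrite addn0 big_geq// mulr_ge0 ?mulr_ge0.
  rewrite big_ltn ?addnS ?ltnS ?leq_addr//.
  have D2 : 2 * D * t n.+1 <= 2 * D * t n by apply: ler_wpM2l; rewrite ?mulr_ge0.
  case: ifPn => [_|/asboolPn nA].
    by rewrite add0r -addSn (le_trans (IH n.+1)).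
  case: (HD n) => [//|[h1 h2]]; apply: le_trans D2.
  rewrite -mulrA mulr_natl mulr2n; apply: lerD; first exact: h1.
  apply: le_trans (h2 (n + m).+1); apply: ler_sum => k _.
  by case: ifP; rewrite ?powR_ge0.
have [g gm gP] : exists2 g : nat -> nat,
    (forall i j, (i <= j)%N -> (g i <= g j)%N) &
    forall k, 2 * x k `^ Q < yR k `^ Q ->
      yR k `^ Q <= 2 * \sum_(g k <= i < g k.+1) x i `^ Q.
  apply: (@tail_blocks _ Q x yR t) => // [k|n N].
    by rewrite /yR; case: ifP.
  have [Nn|/ltnW nN] := leqP N n; first by rewrite big_geq// mulr0.
  rewrite (eq_bigr (fun k => (if A k then 0 else y k `^ Q) / l `^ Q)); last first.
    by move=> k _; rewrite /yR; case: ifP; rewrite ?powR0 ?mul0r ?gt_eqF.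
  rewrite -mulr_suml mulrA ler_pdivrMr// -(subnKC nN).
  apply: (@le_trans _ _ (4 * (2 * D * t n))); first by rewrite ler_pM2l.
  rewrite [leLHS](_ : _ = 8 * D * t n); last by ring.
  by rewrite mulrC; apply: ler_wpM2l.
pose c2 k := if A k then y1 k / x (phi k) else 0.
have Ey2 : carrier E (wcomp c2 phi x).
  apply: Epr => //; apply: (@bounded_operators_wcomp_fill _ _ _ 2) => //.
  - exact: ltW.
  - move=> k; rewrite /c2; case: ifPn => [Ak|_]; last by rewrite lexx ler01.
    by rewrite divr_ge0 ?(ltW (x0 _))// ler_pdivrMr// mul1r phi1.
  move=> i N; have xi : 0 < x i `^ p by exact: powR_gt0.
  rewrite -(ler_pM2r xi); apply: le_trans (phi2 i N); rewrite mulr_suml.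
  rewrite [leLHS]big_mkcond [leRHS]big_mkcond; apply: ler_sum => k _ /=.
  case: eqVneq => [<-|_]; rewrite ?andbT ?andbF// /c2.
  case: ifPn => _; last by rewrite powR0 ?mul0r ?gt_eqF.
  by rewrite powRVM ?(ltW (x0 _))// powRN divfK// gt_eqF// powR_gt0.
pose B1 k := (~~ A k) && (2 * x k `^ Q < y1 k `^ Q).
pose S k := \sum_(g k <= i < g k.+1) x i `^ Q.
have B1P k : B1 k -> 0 < S k /\ y1 k `^ Q <= 2 * S k.
  move=> /andP[nA h]; have := gP k; rewrite /yR (negbTE nA) => /(_ h) h'.
  split => //; have : 0 < y1 k `^ Q.
    by apply: le_lt_trans h; rewrite mulr_ge0// powR_ge0.
  by move=> /lt_le_trans/(_ h'); rewrite pmulr_rgt0.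
pose U := block_op (fun i => x i `^ (Q - 1)) (fun k => if B1 k then y1 k / S k else 0) g.
have Ey1 : carrier E (U x).
  apply: Esq => //; have := bounded_block_op q0 x0 y1_ge0 gm B1P.
  move: s0; rewrite le_eqVlt => /orP[/eqP<-//|s0].
  by apply: bounded_operators_interpolation => //; rewrite (lt_trans sp)// lte_fin.
have Ux k : U x k = if B1 k then y1 k else 0.
  rewrite /U /block_op; case: ifPn => [B1k|_]; last by rewrite mul0r.
  rewrite (eq_bigr (fun i => x i `^ Q)).
    by rewrite divfK// gt_eqF//; have [] := B1P k B1k.
  by move=> i _; rewrite mulrC mulr_powRB1// ltW.
pose y3 : R^nat := fun k => if A k || B1 k then 0 else y1 k.
have Ey3 : carrier E y3.
  apply: (@solid E s q%:E (2 `^ Q^-1) x) => //; first by rewrite lee_fin ltW.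
  move=> k; rewrite /y3 (gtr0_norm (x0 k)); case: ifPn => [_|].
    by rewrite normr0 mulr_ge0 ?powR_ge0 ?(ltW (x0 k)).
  rewrite negb_or /B1 => /andP[nA]; rewrite nA /= -leNgt => h.
  rewrite ger0_norm// (_ : y1 k = (y1 k `^ Q) `^ Q^-1); last first.
    by rewrite -powRrM mulfV ?gt_eqF// powRr1.
  have -> : x k = (x k `^ Q) `^ Q^-1.
    by rewrite -powRrM mulfV ?gt_eqF// powRr1// ltW.
  rewrite -powRM; [|exact: ler0n|exact: powR_ge0].
  apply: le_powR; [by rewrite invr_ge0 ltW|exact: powR_ge0|exact: h].
have -> : y = l *: ((wcomp c2 phi x : R^nat) + U x + y3).
  apply/funext => k; rewrite -[RHS]/(l * (wcomp c2 phi x k + U x k + y3 k)) Ux.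
  rewrite /wcomp /c2 /y3 /B1; case: (boolP (A k)) => Ak /=.
    by rewrite divfK ?gt_eqF// !addr0 /y1 mulrC divfK// gt_eqF.
  by case: ifP => _; rewrite mul0r add0r ?addr0 ?add0r /y1 mulrC divfK// gt_eqF.
by apply: qbZ => //; apply: qbD => //; exact: qbD.
Qed.

End Assembly.

(** * The orbit of a sequence, and the theorem *)

Section Main.
Variable R : realType.
Implicit Types (z : R^nat) (T : R^nat -> R^nat) (E : seq_space R).

Lemma lpsum_le_normr (a B : R) z : lpsum_le a z B -> lpsum_le a (fun k => `|z k|) B.
Proof.
move=> zB N; have := zB N; congr (_ <= _); apply: eq_bigr => k _.
by rewrite /lpterm normr_eq0 normr_id.
Qed.

Lemma wcomp_inj_lpsum (a : R) (c : nat -> R) h : 0 <= a ->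
  (forall n, `|c n| <= 1) ->
  (forall m n, c m != 0 -> c n != 0 -> h m = h n -> m = n) ->
  exists2 B, 0 <= B & forall z M, lpsum_le a z M ->
    lpsum_le a (wcomp c h z) (B * M).
Proof. by move=> a0 c1 hinj; exact: (@lpball_wcomp_inj _ a%:E 1 c h). Qed.

(** The constant C of the K-functional inequality, for one part of the splitting
    and one exponent. *)
Lemma split_sum_le (a K1 K2 Ca M : R) tau x0 (w w' : R^nat) : 0 < a ->
  (forall z M, lpsum_le a z M -> lpsum_le a (wcomp (fun=> 1) tau z) (K1 * M)) ->
  lpsum_le a x0 (K2 * M) -> lpsum_le a w (Ca * (K2 * M)) ->
  forall N, \sum_(k < N) (`|w (tau k)| + `|x0 (tau k)|) `^ a
    <= 2 `^ a * (K1 * (Ca * K2) + K1 * K2) * M.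
Proof.
move=> a0 HK hx hw N.
have hw' := HK _ _ hw N; have hx' := HK _ _ hx N.
apply: (@le_trans _ _ (2 `^ a * (K1 * (Ca * (K2 * M)) + K1 * (K2 * M)))); last first.
  by rewrite le_eqVlt; apply/orP; left; apply/eqP; ring.
apply: (@le_trans _ _ (\sum_(k < N) 2 `^ a *
   (lpterm a (wcomp (fun=> 1) tau w k) + lpterm a (wcomp (fun=> 1) tau x0 k)))).
  apply: ler_sum => k _; rewrite /wcomp !mul1r !lpterm_pos ?gt_eqF//.
  by apply: powR_sum_le => //; exact: ltW.
rewrite -mulr_sumr big_split/=; apply: ler_wpM2l; first exact: powR_ge0.
exact: lerD.
Qed.

Lemma right_inverse (w : nat -> R) (sg : nat -> nat) :
  (forall n, 0 < w n -> exists k, sg k = n) ->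
  exists h : nat -> nat, forall n, 0 < w n -> sg (h n) = n.
Proof.
move=> H; have /choice[h hP] : forall n, exists k, 0 < w n -> sg k = n.
  move=> n; have [/H[k <-]|_] := boolP (0 < w n); first by exists k.
  by exists 0%N.
by exists h.
Qed.

(** Cutting x after its n largest entries, and using the bounds of T on l^p and on
    l^Q with Q = max(q, 1) for the two parts, gives the K-functional inequality
    between the decreasing rearrangements of |x| and of |T x| + |x|. Rearranging,
    changing signs and multiplying by bounded sequences are operators bounded on
    all the spaces, so it is enough to compare the rearrangements. *)
Lemma orbit_in E (s r : \bar R) (p q : R) T x :
  (0 <= s)%E -> (s < p%:E)%E -> 0 < p -> p < q -> (q%:E < r)%E ->
  is_quasi_banach E -> op_invariant E s q%:E -> op_invariant E p%:E r ->
  carrier (lp p%:E) `<=` carrier E -> carrier E `<=` carrier (lp q%:E) ->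
  bounded_operators p%:E q%:E T -> carrier E x -> carrier E (T x).
Proof.
move=> s0 sp p0 pq qr qbE Esq Epr pE Eq [Tlin Tq Tp] Ex.
have q0 : 0 < q by exact: lt_trans pq.
have p0' : (0 <= p%:E)%E by rewrite lee_fin ltW.
have q0' : (0 <= q%:E)%E by rewrite lee_fin ltW.
have T0 := linear_map_on0 q0' Tlin.
have [[n xn]|xinf] := pselect (exists n, forall k, (n <= k)%N -> x k = 0).
  by apply/pE/Tp.1/(carrier_lpP _ p0'); exact: lpball_fin xn.
have {}xinf n : exists2 k, (n <= k)%N & `|x k| != 0.
  apply: contrapT => h; apply: xinf; exists n => k nk; apply/eqP.
  by rewrite -normr_eq0; apply/negPn/negP => xk; apply: h; exists k.
pose Q := Num.max q 1.
have Q1 : 1 <= Q by rewrite le_max lexx orbT.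
have Q0 : 0 < Q by exact: lt_le_trans Q1.
have qQ : (q%:E <= Q%:E)%E by rewrite lee_fin le_max lexx.
have qx := Eq _ Ex.
have [Bx xB] := (carrier_lpP x q0').1 qx.
have [By yB] := (carrier_lpP (T x) q0').1 (Tq.1 _ qx).
(* Adding |x| provides an infinite support, hence a rearrangement indexed by all
   integers. *)
pose y : R^nat := fun k => `|T x k| + `|x k|.
have y_ge0 k : 0 <= y k by rewrite addr_ge0.
have yq := lpsum_leD (ltW q0) (lpsum_le_normr yB) (lpsum_le_normr xB).
have xlim := lpsum_le_vanish q0 xB.
have ylim e (e0 : 0 < e) : exists n, forall k, (n <= k)%N -> y k < e.
  have [n hn] := lpsum_le_vanish q0 yq e0; exists n => k /hn.
  by move=> /(le_lt_trans (ler_norm _)).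
have yinf n : exists2 k, (n <= k)%N & y k != 0.
  have [k nk xk] := xinf n; exists k => //.
  by rewrite gt_eqF// ltr_wpDl// lt_neqAle eq_sym xk normr_ge0.
have [sg [sginj sgpos sgdec sgsurj]] :=
  decreasing_rearrangement (fun k => normr_ge0 (x k)) xlim xinf.
have [tau [tauinj taupos taudec tausurj]] :=
  decreasing_rearrangement y_ge0 ylim yinf.
have [hs hsP] := right_inverse sgsurj; have [ht htP] := right_inverse tausurj.
pose xs : nat -> R := fun k => `|x (sg k)|; pose ys : nat -> R := fun k => y (tau k).
pose xg : R^nat := fun k => x (sg k).
pose c i : R := (x i != 0)%:R.
have c1 i : `|c i| <= 1 by rewrite /c normr_nat lern1 leq_b1.
have cinj m n : c m != 0 -> c n != 0 -> hs m = hs n -> m = n.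
  rewrite /c !pnatr_eq0 !eqb0 !negbK -!normr_gt0 => /hsP {2}<- /hsP {2}<- ->.
  by [].
have one_inj m n : (1 : R) != 0 -> (1 : R) != 0 -> tau m = tau n -> m = n.
  by move=> _ _; exact: tauinj.
have one_inj' m n : (1 : R) != 0 -> (1 : R) != 0 -> sg m = sg n -> m = n.
  by move=> _ _; exact: sginj.
have one1 (n : nat) : `|1 : R| <= 1 by rewrite normr1.
have [K1p K1p0 HK1p] := wcomp_inj_lpsum (ltW p0) one1 one_inj.
have [K1Q K1Q0 HK1Q] := wcomp_inj_lpsum (ltW Q0) one1 one_inj.
have [K2p K2p0 HK2p] := wcomp_inj_lpsum (ltW p0) c1 cinj.
have [K2Q K2Q0 HK2Q] := wcomp_inj_lpsum (ltW Q0) c1 cinj.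
have [K3 K30 HK3] := wcomp_inj_lpsum (ltW Q0) one1 one_inj'.
have [Cp Cp0 TCp] := (bounded_lpP p0' T0).1 Tp.
have [CQ CQ0 TCQ] := bounded_lp_max1 q0 Tlin Tq.
have [t tx] : exists t, tail_of (fun k => xs k `^ Q) t.
  have [B' xB' _] := lpball_sub q0 qQ xB.
  apply: (@exists_tail _ _ (K3 * B')) => [k|N]; first exact: powR_ge0.
  have := HK3 _ _ xB' N; congr (_ <= _); apply: eq_bigr => k _.
  by rewrite /wcomp mul1r lpterm_pos ?gt_eqF.
have [t_ge0 _ _] := tx.
pose C := 2 `^ p * (K1p * (Cp * K2p) + K1p * K2p) +
  2 `^ Q * (K1Q * (CQ * K2Q) + K1Q * K2Q).
have Ca0 : 0 <= 2 `^ p * (K1p * (Cp * K2p) + K1p * K2p).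
  by rewrite mulr_ge0 ?powR_ge0// addr_ge0// !mulr_ge0.
have Cb0 : 0 <= 2 `^ Q * (K1Q * (CQ * K2Q) + K1Q * K2Q).
  by rewrite mulr_ge0 ?powR_ge0// addr_ge0// !mulr_ge0.
have C0 : 0 <= C by exact: addr_ge0.
have Exs : carrier E xs.
  have -> : xs = wcomp (fun k => Num.sg (x (sg k))) sg x.
    by apply/funext => k; rewrite /wcomp /xs -normrEsg.
  apply: Esq => //; apply: (@bounded_operators_wcomp_inj _ _ _ 1) => //.
    by move=> k; rewrite normr_sg lern1 leq_b1.
  by move=> m n _ _; exact: sginj.
have Eys : carrier E ys.
  have ys_ge0 n : 0 <= ys n by exact: y_ge0.
  apply: (@sorted_transfer _ E p q C s r xs ys t) => // n.
(* x0 collects the n largest entries of x, x1 the other ones. *)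
  pose x0 := wcomp c hs (trunc n xg); pose x1 := wcomp c hs (xg - trunc n xg).
  have xE : x = x0 + x1.
    apply/funext => i; rewrite /x0 /x1 -[RHS]/(wcomp _ _ _ i + wcomp _ _ _ i).
    rewrite /wcomp -mulrDr -[(xg - _) _]/(xg (hs i) - trunc n xg (hs i)) subrKC /c.
    have [->|xi] := eqVneq (x i) 0; first by rewrite mul0r.
    by rewrite mul1r /xg hsP// normr_gt0.
  have M0 : lpsum_le p (trunc n xg) (\sum_(k < n) xs k `^ p).
    have tr0 k : (n <= k)%N -> trunc n xg k = 0 by move=> nk; rewrite /trunc ltnNge nk.
    have := lpsum_le_fin p tr0; congr lpsum_le; apply: eq_bigr => k _.
    by rewrite /trunc ltn_ord lpterm_pos ?gt_eqF.
  have M1 : lpsum_le Q (xg - trunc n xg) (t n).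
    move=> N; rewrite -(big_mkord xpredT (fun k => lpterm Q ((xg - trunc n xg) k))).
    have z0 k : (k < n)%N -> lpterm Q ((xg - trunc n xg) k) = 0.
      by move=> kn; rewrite /trunc !fctE kn subrr lpterm0.
    have [Nn|/ltnW nN] := leqP N n.
      by rewrite big_nat big1// => k /andP[_ kN]; rewrite z0// (leq_trans kN).
    rewrite (@big_cat_nat _ _ _ n)//= big_nat big1 ?add0r; last first.
      by move=> k /andP[_ kn]; rewrite z0.
    rewrite (eq_big_nat _ _ (F2 := fun k => xs k `^ Q)); last first.
      move=> k /andP[nk _]; rewrite /trunc !fctE ltnNge nk subr0.
      by rewrite lpterm_pos ?gt_eqF.
    by rewrite (tail_sum tx nN) lerBlDr lerDl.
  have h0 := HK2p _ _ M0; have h1 := HK2Q _ _ M1.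
  have qx0 : carrier (lp q%:E) x0.
    apply: (@carrier_lp_sub _ p%:E) => //; first by rewrite lee_fin ltW.
    by apply/(carrier_lpP _ p0'); eexists; exact: h0.
  have qx1 : carrier (lp q%:E) x1.
    rewrite (_ : x1 = x - x0); last by rewrite xE addrC addKr.
    exact: carrier_lpB.
  exists (fun k => `|T x0 (tau k)| + `|x0 (tau k)|).
  exists (fun k => `|T x1 (tau k)| + `|x1 (tau k)|); split.
  - by move=> k; exact: addr_ge0.
  - by move=> k; exact: addr_ge0.
  - move=> k; rewrite /ys /y {1 2}xE (linear_map_onD q0' Tlin qx0 qx1) !fctE addrACA.
    by apply: lerD; exact: ler_normD.
  - move=> N.
    apply: le_trans (split_sum_le (T x0) p0 HK1p h0 (TCp _ _ h0) N) _.
    apply: ler_wpM2r; last by rewrite lerDl.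
    by rewrite sumr_ge0// => k _; exact: powR_ge0.
  - move=> N.
    apply: le_trans (split_sum_le (T x0) Q0 HK1Q h1 (TCQ _ _ qx1 h1) N) _.
    by apply: ler_wpM2r => //; rewrite lerDr.
have -> : T x = wcomp (fun i => T x i / y i) ht ys.
  apply/funext => i; rewrite /wcomp /ys; have [yi|yi] := eqVneq (y i) 0.
    rewrite yi invr0 mulr0 mul0r; apply/eqP; rewrite -normr_le0 -yi lerDl//.
  by rewrite htP ?divfK// lt_neqAle eq_sym yi y_ge0.
apply: Esq => //; apply: (@bounded_operators_wcomp_inj _ _ _ 1) => //.
  move=> i; rewrite normrM normfV (ger0_norm (y_ge0 i)).
  have [->|yi] := eqVneq (y i) 0; first by rewrite invr0 mulr0.
  by rewrite ler_pdivrMr ?mul1r ?lerDl// lt_neqAle eq_sym yi y_ge0.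
have pos m : T x m / y m != 0 -> tau (ht m) = m.
  move=> h; apply: htP; rewrite lt_neqAle eq_sym y_ge0 andbT.
  by apply: contraNneq h => ->; rewrite invr0 mulr0.
by move=> m n /pos {2}<- /pos {2}<- ->.
Qed.

(** A continuous T on l^q that maps E into E is bounded on E. *)
Lemma Int_sup (s p q r : \bar R) : (0 <= s)%E -> (s < p)%E -> (p < q)%E ->
  (q < r)%E -> Int s q `&` Int p r `<=` @Int R p q.
Proof.
move=> s0 sp pq qr E [[qbE _ Eq TEs] [_ pE _ TEp]]; split => //.
have p0 := le_lt_trans s0 sp; have q0 := lt_trans p0 pq.
move=> T hT; have [Tlin Tq _] := hT; apply: (closed_graph q0) => // x Ex.
case: q pq qr q0 Eq TEs hT Tlin Tq => [q||]// pq qr q0 Eq TEs hT Tlin Tq; last first.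
  by move: qr; rewrite ltNge leey.
case: p sp pq p0 pE TEp hT => [p||]// sp pq p0 pE TEp hT.
rewrite !lte_fin in p0 pq.
apply: (@orbit_in E s r p q T x) => //.
- by move=> U hU z Ez; exact: (TEs U hU).1.
- by move=> U hU z Ez; exact: (TEp U hU).1.
- exact: pE.1.
- exact: Eq.1.
Qed.

End Main.

Theorem theorem4p1 (R : realType) (s p q r : \bar R)
    (hs : (0 <= s)%E) (hsp : (s < p)%E) (hpq : (p < q)%E) (hqr : (q < r)%E) :
  Int p q = (Int s q `&` Int p r)%classic.
Proof.
by apply/seteqP; split; [exact: Int_sub|exact: Int_sup].
Qed.
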